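(* Let $p\in(1,+\infty)$ and let $\mathcal{G}=\|\cdot\|_{\ell^p}$ on $\mathbb{R}^6$. Then $\Psi_{\mathcal{G}}:\mathbb{G}(4,2)\to(0,\infty)$ satisfies (AC1), i.e. $\dim\ker A(\mu)\le 2$ for every Borel probability measure $\mu$ on $\mathbb{G}(4,2)$.
   Context: $\mathbb{G}(4,2)=\{P\in\mathbb{R}^{4\times4}:P=P^t,\ P^2=P,\ \mathrm{tr}(P)=2\}$; $T^\perp:=\mathrm{id}-T$. For linearly independent $v_1,v_2\in\mathbb{R}^4$ let $T(v_1\wedge v_2)$ be the orthogonal projection onto $\mathrm{span}\{v_1,v_2\}$. The space $\Lambda_2(\mathbb{R}^4)$ carries the scalar product determined by $\langle v_1\wedge v_2,w_1\wedge w_2\rangle=\det\big((v_i,w_j)\big)_{i,j}$, with norm $\|\cdot\|$; set $v_{ij}:=\langle v_1\wedge v_2,e_i\wedge e_j\rangle$, where $e_1,\dots,e_4$ is the canonical basis. For an even, $1$-homogeneous $\mathcal{G}:\mathbb{R}^6\to\mathbb{R}$ set $\Phi(v_1\wedge v_2):=\mathcal{G}(v_{12},v_{13},v_{14},v_{23},v_{24},v_{34})$ and $\Psi_{\mathcal{G}}(T):=\Phi\big(\tfrac{v_1\wedge v_2}{\|v_1\wedge v_2\|}\big)$ if $T=T(v_1\wedge v_2)$ (well defined by evenness and homogeneity). For $\Psi\in C^1(\mathbb{G}(4,2))$, $D\Psi(T)$ denotes the differential (as a matrix, with respect to the Frobenius inner product) of any $C^1$ extension of $\Psi$ to a neighborhood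 of $\mathbb{G}(4,2)$ in $\mathbb{R}^{4\times4}$, $d\Psi(T):=D\Psi(T)+D\Psi(T)^t$, and $B_\Psi(T):=\Psi(T)T+T^\perp d\Psi(T)T$ (independent of the extension). For $\Psi=\Psi_{\mathcal{G}}$, $A(\mu):=\int_{\mathbb{G}(4,2)}B_{\Psi}(T)\,d\mu(T)\in\mathbb{R}^{4\times4}$. *)

(* Defs.v *)
From HB Require Import structures.
From mathcomp Require Import all_boot all_order all_algebra.
From mathcomp Require Import all_classical all_reals all_analysis.
Set Implicit Arguments.
Unset Strict Implicit.
Unset Printing Implicit Defensive.
Import Order.TTheory GRing.Theory Num.Theory.
Import numFieldNormedType.Exports.
Local Open Scope classical_set_scope.
Local Open Scope ring_scope.

Definition G42 (R : realType) : set 'M[R]_4 :=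
  [set P | [/\ P = P^T, P *m P = P & \tr P = 2%:R]].

(* The Grassmannian as a type, with the topology induced by 'M[R]_4. *)
Definition Gr (R : realType) : Type := set_type (@G42 R).

Section Gr_instances.
Variable R : realType.

Lemma G42_pid_mx : pid_mx 2 \in @G42 R.
Proof.
apply/mem_set; split; first by rewrite tr_pid_mx.
- by rewrite mul_pid_mx.
- by rewrite /mxtrace !big_ord_recl big_ord0 !mxE /= !addr0.
Qed.

HB.instance Definition _ := Topological.copy (Gr R) (set_type (@G42 R)).
HB.instance Definition _ := isPointed.Build (Gr R) (exist _ (pid_mx 2) G42_pid_mx).

End Gr_instances.

Definition GrBorel (R : realType) := g_sigma_algebraType (@open (Gr R)).

(* A pair (v_1, v_2) of vectors of R^4 is given as the matrix V with rows
   v_1, v_2.  This is <v_1 /\ v_2, w_1 /\ w_2> = det((v_i, w_j)). *)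
Definition wdot (R : realType) (V W : 'M[R]_(2, 4)) : R := \det (V *m W^T).

Definition wnorm (R : realType) (V : 'M[R]_(2, 4)) : R := Num.sqrt (wdot V V).

Definition basis_pair (R : realType) (i j : 'I_4) : 'M[R]_(2, 4) :=
  col_mx (delta_mx 0 i : 'rV[R]_4) (delta_mx 0 j).

Definition index_pairs : 6.-tuple ('I_4 * 'I_4) :=
  [tuple (inord 0, inord 1); (inord 0, inord 2); (inord 0, inord 3);
         (inord 1, inord 2); (inord 1, inord 3); (inord 2, inord 3)].

(* The 2-vector v_1 /\ v_2, identified with its coordinates
   (v_12, v_13, v_14, v_23, v_24, v_34) in the orthonormal basis
   (e_i /\ e_j)_(i < j).  With this identification Phi is G itself. *)
Definition wedge (R : realType) (V : 'M[R]_(2, 4)) : 'rV[R]_6 :=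
  \row_k wdot V (basis_pair R (tnth index_pairs k).1 (tnth index_pairs k).2).

(* The projection onto the row span of V along its orthogonal complement
   {u | u V^T = 0}. *)
Definition orth_proj (R : realType) (V : 'M[R]_(2, 4)) : 'M[R]_4 :=
  proj_mx <<V>>%MS (kermx V^T).

Definition spanning_pair (R : realType) (T : Gr R) : 'M[R]_(2, 4) :=
  xget 0 [set V | row_free V /\ orth_proj V = val T].

(* By PsiE below, the choice made by spanning_pair is immaterial. *)
Definition Psi (R : realType) (G : 'rV[R]_6 -> R) (T : Gr R) : R :=
  let V := spanning_pair T in G ((wnorm V)^-1 *: wedge V).

Definition lp_norm (R : realType) (p : R) (x : 'rV[R]_6) : R :=
  (\sum_k `|x 0 k| `^ p) `^ p^-1.

Section C1.
Variable R : realType.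

(* Every 'd F Y lives on the finite-dimensional space 'M[R]_4, so that the
   continuity of Y |-> 'd F Y amounts to that of Y |-> 'd F Y H for all H. *)
Definition C1_on (U : set 'M[R]_4) (F : 'M[R]_4 -> R) : Prop :=
  (forall X, U X -> differentiable F X) /\
  (forall H X, U X -> {for X, continuous (fun Y => 'd F Y H)}).

Definition C1_extension (f : Gr R -> R) (F : 'M[R]_4 -> R) : Prop :=
  (forall T : Gr R, F (val T) = f T) /\
  (exists U : set 'M[R]_4, [/\ open U, @G42 R `<=` U & C1_on U F]).

Definition C1_Gr (f : Gr R -> R) : Prop := exists F, C1_extension f F.

(* Gradient for the Frobenius inner product: 'd F X H = \tr (grad F X)^T H. *)
Definition grad (F : 'M[R]_4 -> R) (X : 'M[R]_4) : 'M[R]_4 :=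
  \matrix_(i, j) 'd F X (delta_mx i j).

Definition Bmx (f : Gr R -> R) (F : 'M[R]_4 -> R) (T : Gr R) : 'M[R]_4 :=
  let P : 'M[R]_4 := val T in
  f T *: P + (1%:M - P) *m (grad F P + (grad F P)^T) *m P.

Definition Amx (f : Gr R -> R) (F : 'M[R]_4 -> R)
    (mu : probability (GrBorel R) R) : 'M[R]_4 :=
  \matrix_(i, j) (\int[mu]_T Bmx f F T i j).

(* kermx is the left kernel, hence the transpose. *)
Definition dim_ker (A : 'M[R]_4) : nat := \rank (kermx A^T).

(* Bmx f F does not depend on the C^1 extension F of f; AC1 is stated for all
   of them. *)
Definition AC1 (f : Gr R -> R) : Prop :=
  forall F : 'M[R]_4 -> R, C1_extension f F ->
  forall mu : probability (GrBorel R) R, (dim_ker (Amx f F mu) <= 2)%N.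

End C1.

Section well_defined.
Variable R : realType.
Implicit Types V W : 'M[R]_(2, 4).

Lemma span_orthI V : (V :&: kermx V^T = 0)%MS.
Proof.
apply/eqP/rowV0P => u; rewrite sub_capmx => /andP[/submxP[D ->]] /sub_kermxP.
move=> h; have : (D *m V) *m (D *m V)^T = 0 by rewrite trmx_mul mulmxA h mul0mx.
move: (D *m V) => w /matrixP/(_ 0 0); rewrite !mxE => /eqP.
rewrite psumr_eq0 => [/allP w0|i _]; last by rewrite mxE -expr2 sqr_ge0.
apply/rowP => i; rewrite mxE; have := w0 i (mem_index_enum _).
by rewrite mxE -expr2 sqrf_eq0 => /eqP.
Qed.

Lemma orth_proj_span V : (orth_proj V :=: V)%MS.
Proof.
apply/eqmxP/andP; split.
  by rewrite -(genmxE V) -[orth_proj V]mul1mx proj_mx_sub.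
have e : V *m orth_proj V = V.
  apply: proj_mx_id; last by rewrite genmxE.
  by apply/eqP; rewrite -submx0 -(span_orthI V) capmxS ?genmxE.
by rewrite -{1}e submxMl.
Qed.

Lemma wdotMl (M : 'M[R]_2) V W : wdot (M *m V) W = \det M * wdot V W.
Proof. by rewrite /wdot -mulmxA det_mulmx. Qed.

Lemma wdotMr (M : 'M[R]_2) V W : wdot V (M *m W) = \det M * wdot V W.
Proof. by rewrite /wdot trmx_mul mulmxA det_mulmx det_tr mulrC. Qed.

Lemma PsiE (G : 'rV[R]_6 -> R) (T : Gr R) V : (forall x, G (- x) = G x) ->
  row_free V -> orth_proj V = val T ->
  Psi G T = G ((wnorm V)^-1 *: wedge V).
Proof.
move=> G_even Vfree VT; rewrite /Psi /=.
have [] : row_free (spanning_pair T) /\ orth_proj (spanning_pair T) = val T.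
  by rewrite /spanning_pair; case: xgetP => [W _ //|/(_ V)]; case.
move: (spanning_pair T) => W Wfree WT.
have /submxP[M WE] : (W <= V)%MS.
  by rewrite -(orth_proj_span W) WT -VT orth_proj_span.
have M0 : \det M != 0.
  rewrite -unitfE -[_ \is a _]/(M \in unitmx) -row_full_unit -col_leq_rank.
  move: Wfree; rewrite /row_free WE => /eqP rW.
  by rewrite -{1}rW mxrankM_maxl.
have -> : wedge W = \det M *: wedge V.
  by apply/rowP => k; rewrite !mxE WE wdotMl.
have -> : wnorm W = `|\det M| * wnorm V.
  by rewrite /wnorm WE wdotMl wdotMr mulrA -expr2 sqrtrM ?sqr_ge0// sqrtr_sqr.
rewrite scalerA invfM mulrAC.
have [M_gt0|M_lt0|/eqP] := ltrgt0P (\det M); last by rewrite (negPf M0).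
  by rewrite mulVf ?mul1r.
by rewrite invrN mulNr mulVf // mulN1r scaleNr G_even.
Qed.

End well_defined.

(* Main.v *)
Require Import Defs.
From HB Require Import structures.
From mathcomp Require Import all_boot all_order all_algebra.
From mathcomp Require Import all_classical all_reals all_analysis.
From mathcomp Require Import measurable_realfun.
From mathcomp Require Import ring lra.
Set Implicit Arguments.
Unset Strict Implicit.
Unset Printing Implicit Defensive.
Import Order.TTheory GRing.Theory Num.Theory.
Import numFieldNormedType.Exports.
Local Open Scope classical_set_scope.
Local Open Scope ring_scope.

(* Encode the unit simple 2-vector of a plane T by the antisymmetric 4x4 matrix X
   of its Plucker coordinates, and let S be the matrix of the
   sgn(X_ij) |X_ij|^(p-1).  Differentiating Psi along curves of planes gives
     B(T) = |X|_p^(1-p) S X^T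
   for every C^1 extension.  Put t_ij = |X|_p^(1-p) |X_ij|^p, so that
   B_ii = sum_k t_ik.  For i <> j the terms k = i and k = j of
   sum_k S_ik X_jk vanish, and Hoelder's inequality gives
     |A_ij| <= (A_ii - tau_ij)^(1-1/p) (A_jj - tau_ij)^(1/p)
   with A the integral of B and tau that of t.  As sum_ij t_ij = 2 Psi > 0, some
   tau_ij is positive, and then |A_ij A_ji| < A_ii A_jj: a 2x2 minor of A does
   not vanish, A has rank at least 2, and its kernel has dimension at most 2. *)

(** * Plucker coordinates *)

Lemma det_mx22 (K : comPzRingType) (M : 'M[K]_2) :
  \det M = M 0 0 * M 1 1 - M 0 1 * M 1 0.
Proof.
rewrite (expand_det_row _ 0) !big_ord_recl big_ord0 /cofactor !det_mx11 !mxE /=.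
rewrite /= expr0 expr1 mul1r addr0 mulN1r mulrN.
by congr (_ * M _ _ - M _ _ * M _ _); apply/val_inj.
Qed.

(** Selecting columns is a right multiplication and selecting rows stays in the row space, so the
    rank of an invertible 2x2 submatrix bounds that of A from below. *)
Lemma rank_ge2 (K : fieldType) n (A : 'M[K]_n) (i j : 'I_n) :
  A i i * A j j != A i j * A j i -> (2 <= \rank A)%N.
Proof.
pose f (k : 'I_2) := if k == 0 then i else j.
move=> hA; have : \rank (mxsub f f A) = 2%N.
  apply/eqP; rewrite -[_ == _]/(row_free _) row_free_unit unitmxE unitfE.
  by rewrite det_mx22 !mxE /= subr_eq0.
have -> : mxsub f f A = rowsub f (A *m colsub f 1%:M).
  by rewrite mulmx_colsub mulmx1 mxsubrc.
by move=> <-; apply: leq_trans (mxrankS (rowsub_sub _ _)) (mxrankM_maxl _ _).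
Qed.

Lemma dim_ker_le2 (R : realType) (A : 'M[R]_4) (i j : 'I_4) :
  A i i * A j j != A i j * A j i -> (dim_ker A <= 2)%N.
Proof.
move=> /rank_ge2 rA; rewrite /dim_ker mxrank_ker mxrank_tr.
by rewrite leq_subLR -(leq_add2r 2) leq_add2r; rewrite -[4%N]/(2 + 2)%N leq_add2r.
Qed.

Section Plucker.
Variable R : realType.
Implicit Types (V : 'M[R]_(2, 4)) (T : Gr R).

Definition plucker V : 'M[R]_4 := \matrix_(i, j) (V 0 i * V 1 j - V 0 j * V 1 i).

Lemma pluckerC V i j : plucker V j i = - plucker V i j.
Proof. by rewrite !mxE opprB. Qed.

Lemma plucker_diag V i : plucker V i i = 0.
Proof. by rewrite mxE subrr. Qed.

Lemma wdot_basis_pair V i j : wdot V (basis_pair R i j) = plucker V i j.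
Proof.
have E r s : (V *m (basis_pair R i j)^T) r s = V r (if s == 0 then i else j).
  rewrite mxE (bigD1 (if s == 0 then i else j)) //= big1 ?addr0.
    rewrite /basis_pair !mxE; case: splitP => k; rewrite !mxE ord1 => /eqP /=.
      by rewrite -[_ == 0%N]/(s == 0) => ->; rewrite !eqxx mulr1.
    by case: (s =P 0) => [->|_]; rewrite ?eqxx ?mulr1.
  move=> l lk; rewrite /basis_pair !mxE; case: splitP => k; rewrite !mxE ord1 => /eqP /=.
    rewrite -[_ == 0%N]/(s == 0) => s0; move: lk; rewrite s0 => /negPf ->.
    by rewrite mulr0.
  case: (s =P 0) lk => [->|_] // /negPf ->.
  by rewrite mulr0.
by rewrite /wdot det_mx22 !E /= !mxE [X in _ - X]mulrC [X in _ - X]mulrC.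
Qed.

(** Passes from the six pairs i < j to sums over full matrices: the diagonal contributes nothing and
    each pair is counted twice. *)
Lemma sum_index_pairs (f : 'I_4 -> 'I_4 -> R) :
  (forall i j, f j i = f i j) -> (forall i, f i i = 0) ->
  \sum_k f (tnth index_pairs k).1 (tnth index_pairs k).2 =
  (\sum_i \sum_j f i j) / 2.
Proof.
move=> fC f0.
have s4 (g : 'I_4 -> R) : \sum_i g i = g (inord 0) + g (inord 1) + g (inord 2) + g (inord 3).
  rewrite !big_ord_recl big_ord0 addr0 !addrA.
  by congr (g _ + g _ + g _ + g _); apply/val_inj; rewrite /= inordK.
rewrite !s4 !f0 !big_ord_recl big_ord0 addr0 !(tnth_nth (0, 0)) /=.
rewrite !(fC (inord 0)) !(fC (inord 1) (inord 2)) !(fC (inord 1) (inord 3)).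
rewrite (fC (inord 2) (inord 3)).
lra.
Qed.

End Plucker.

(** * Orthonormal frames *)

Section Frames.
Variable R : realType.
Implicit Types (V : 'M[R]_(2, 4)) (T : Gr R).

Lemma row_free_gram V (K : 'M[R]_2) : V *m V^T *m K = 1%:M -> row_free V.
Proof. by move=> h; apply/row_freeP; exists (V^T *m K); rewrite mulmxA. Qed.

(** The classical formula with the inverse Gram matrix [K]. In the splitting 1 = (1 - W) + W the
    rows of the first summand lie in the kernel of V^T and are annihilated; those of the second lie
    in the span of V and are fixed. *)
Lemma orth_proj_gram V (K : 'M[R]_2) :
  V *m V^T *m K = 1%:M -> orth_proj V = V^T *m K *m V.
Proof.
move=> h; have h' : K *m (V *m V^T) = 1%:M by apply: mulmx1C.
have dx : (<<V>> :&: kermx V^T = 0)%MS.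
  by apply/eqP; rewrite -submx0 -(span_orthI V) capmxS ?genmxE.
rewrite -[LHS]mul1mx; set W := V^T *m K *m V.
rewrite -[X in X *m _](subrK W) mulmxDl /orth_proj proj_mx_0 ?add0r //.
  by rewrite proj_mx_id // genmxE submxMl.
apply/sub_kermxP; rewrite mulmxBl mul1mx /W -!mulmxA h' mulmx1.
by rewrite subrr.
Qed.

Lemma G42_gram V (K : 'M[R]_2) : V *m V^T *m K = 1%:M -> K^T = K ->
  V^T *m K *m V \in @G42 R.
Proof.
move=> h KT; apply/mem_set; split.
- by rewrite !trmx_mul trmxK KT mulmxA.
- by rewrite !mulmxA -[_ *m V *m V^T]mulmxA -[_ *m K *m _ *m K]mulmxA h mulmx1.
- by rewrite -mulmxA mxtrace_mulC -mulmxA mxtrace_mulC h mxtrace1.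
Qed.

Lemma mulmx_tr_diag m n (A : 'M[R]_(m, n)) i : (A *m A^T) i i = \sum_j A i j ^+ 2.
Proof. by rewrite mxE; apply: eq_bigr => j _; rewrite [A^T j i]mxE. Qed.

(** Idempotency makes every row of Q a vector fixed by Q; a nonzero one is normalised. *)
Lemma exists_unit_row (Q : 'M[R]_4) : Q = Q^T -> Q *m Q = Q -> Q != 0 ->
  exists2 v : 'rV[R]_4, v *m Q = v & v *m v^T = 1%:M.
Proof.
move=> QT QQ /eqP Q0.
have [i ri] : exists i, row i Q != 0.
  apply/existsP; apply: contra_notT Q0 => /existsPn h; apply/row_matrixP => i.
  by move: (h i); rewrite negbK row0 => /eqP.
pose n := (row i Q *m (row i Q)^T) 0 0.
have n0 : 0 < n.
  rewrite /n mulmx_tr_diag lt0r sumr_ge0 ?andbT; last by move=> j _; exact: sqr_ge0.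
  apply: contra ri; rewrite psumr_eq0; last by move=> j _; exact: sqr_ge0.
  move=> /allP h; apply/eqP/rowP => j; move: (h j (mem_index_enum _)) => /=.
  by rewrite sqrf_eq0 => /eqP ->; rewrite mxE.
exists ((Num.sqrt n)^-1 *: row i Q); first by rewrite -scalemxAl -row_mul QQ.
rewrite linearZ /= -scalemxAl -scalemxAr scalerA [X in _ *: X]mx11_scalar -/n.
by rewrite -mul_scalar_mx -scalar_mxM -invfM -expr2 sqr_sqrtr ?ltW // mulVf ?gt_eqF.
Qed.

(** Two unit vectors are split off the range one after the other. Each lowers the trace by one, and
    the remaining projection, of trace zero, must vanish. *)
Lemma orthonormal_frame T :
  exists2 V : 'M[R]_(2, 4), V *m V^T = 1%:M & V^T *m V = val T.
Proof.
case: T => P /=; rewrite inE => -[PT PP trP].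
have tr1 (v : 'rV[R]_4) : v *m v^T = 1%:M -> \tr (v^T *m v) = 1.
  by rewrite mxtrace_mulC => ->; rewrite mxtrace1.
(* Deflation: removing the line of a fixed unit vector leaves an orthogonal projection that kills
   this vector. *)
have defl (Q : 'M[R]_4) (v : 'rV[R]_4) : Q = Q^T -> Q *m Q = Q ->
    v *m Q = v -> v *m v^T = 1%:M ->
    [/\ Q - v^T *m v = (Q - v^T *m v)^T,
       (Q - v^T *m v) *m (Q - v^T *m v) = Q - v^T *m v &
       (Q - v^T *m v) *m v^T = 0].
  move=> QT QQ vQ vv.
  have Qv : Q *m v^T = v^T by rewrite [in LHS]QT -trmx_mul vQ.
  split.
  - by rewrite linearB /= trmx_mul trmxK -QT.
  - rewrite mulmxBl !mulmxBr QQ mulmxA Qv -!mulmxA vQ [v *m (_ *m _)]mulmxA vv.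
    by rewrite mul1mx subrr subr0.
  - by rewrite mulmxBl Qv -mulmxA vv mulmx1 subrr.
have P0 : P != 0.
  by apply: contra_eqN trP => /eqP ->; rewrite mxtrace0 eq_sym pnatr_eq0.
have [v vP vv] := exists_unit_row PT PP P0.
have [QT QQ Qv] := defl _ _ PT PP vP vv.
set Q := P - v^T *m v in QT QQ Qv.
have trQ : \tr Q = 1 by rewrite linearB /= trP tr1 //; lra.
have Q0 : Q != 0.
  by apply: contra_eqN trQ => /eqP ->; rewrite mxtrace0 eq_sym oner_eq0.
have [w wQ ww] := exists_unit_row QT QQ Q0.
have [ST SS Sw] := defl _ _ QT QQ wQ ww.
set S := Q - w^T *m w in ST SS Sw.
have trS : \tr S = 0 by rewrite linearB /= trQ tr1 // subrr.
(* If S were nonzero, a third deflation would leave a projection U of trace tr S - 1; as tr U = tr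
   (U U^T) >= 0, this forces tr S >= 1. *)
have S0 : S = 0.
  apply: contra_eq trS => S0; have [u uS uu] := exists_unit_row ST SS S0.
  have [UT UU _] := defl _ _ ST SS uS uu.
  set U := S - _ in UT UU.
  have : 0 <= \tr U.
    rewrite -UU {2}UT /mxtrace sumr_ge0 // => i _.
    by rewrite mulmx_tr_diag sumr_ge0 // => j _; exact: sqr_ge0.
  by rewrite linearB /= tr1 // subr_ge0 => h; rewrite gt_eqF // (lt_le_trans _ h).
have wv : w *m v^T = 0 by rewrite -wQ -mulmxA Qv mulmx0.
have vw : v *m w^T = 0 by rewrite -[LHS]trmxK trmx_mul trmxK wv trmx0.
have WW : col_mx v w *m (col_mx v w)^T = 1%:M.
  by rewrite tr_col_mx mul_col_row vv ww vw wv -scalar_mx_block.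
have PE : (col_mx v w)^T *m col_mx v w = P.
  rewrite tr_col_mx mul_row_col.
  by move/eqP: S0; rewrite subr_eq0 => /eqP <-; rewrite addrC subrK.
by exists (col_mx v w).
Qed.

End Frames.

(** * The derivative of the p-th power *)

Lemma near_eq_continuous (S T : topologicalType) (f g : S -> T) (x : S) :
  (\forall y \near x, f y = g y) -> {for x, continuous g} -> {for x, continuous f}.
Proof.
move=> fg cg; rewrite /prop_for /continuous_at.
have -> : f x = g x by exact: nbhs_singleton fg.
by apply: cvg_trans cg; apply: near_eq_cvg; apply: filterS fg => y ->.
Qed.

Lemma cvg_norm_powR0 {R : realType} {q : R} : 0 < q -> `|x| `^ q @[x --> (0 : R)] --> (0 : R).
Proof.
move=> q0; apply/cvgrPdist_lt => e e0; near=> x.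
rewrite sub0r normrN ger0_norm ?powR_ge0 //.
have -> : e = (e `^ q^-1) `^ q by rewrite -powRrM mulVf ?gt_eqF // powRr1 ?ltW.
apply: gt0_ltr_powR => //; rewrite ?nnegrE ?powR_ge0 //.
near: x; exists (e `^ q^-1); first exact: powR_gt0. by move=> y; rewrite /ball_ /= sub0r normrN.
Unshelve. all: by end_near. Qed.

Lemma powR_div {R : realType} (u a r : R) : 0 <= u -> 0 <= a -> (u / a) `^ r = u `^ r / a `^ r.
Proof.
move=> u0 a0; rewrite powRM ?invr_ge0 //; congr (_ * _).
by rewrite -powR_inv1 // powRAC powR_inv1 ?powR_ge0.
Qed.

Section SignedPower.
Variables (R : realType) (p : R).
Hypothesis p_gt1 : 1 < p.
Implicit Types x y : R.

(** This is the derivative of |x|^p divided by p. *)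
Definition spow x : R := Num.sg x * `|x| `^ (p - 1).

Let p_gt0 : 0 < p. Proof. by rewrite (lt_trans _ p_gt1). Qed.
Let p1_gt0 : 0 < p - 1. Proof. by rewrite subr_gt0. Qed.

Lemma mul_spow x : x * spow x = `|x| `^ p.
Proof. by rewrite mulrA [x * _]mulrC -normrEsg mulr_powRB1. Qed.

Lemma spow0 : spow 0 = 0.
Proof. by rewrite /spow sgr0 mul0r. Qed.

Lemma spowN x : spow (- x) = - spow x.
Proof. by rewrite /spow sgrN normrN mulNr. Qed.

Lemma norm_spow x : `|spow x| = `|x| `^ (p - 1).
Proof.
rewrite normrM (ger0_norm (powR_ge0 _ _)) normr_sg.
by have [->|] := eqVneq x 0; rewrite ?mul1r // normr0 powR0 ?gt_eqF ?mulr0.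
Qed.

Lemma is_derive_norm_powR x :
  is_derive x 1 (fun y => `|y| `^ p) (p * spow x).
Proof.
have [x0|x0|->] := ltrgt0P x.
- have h : is_derive x 1 (@powR R ^~ p) (p * spow x).
    by rewrite /spow gtr0_sg // mul1r gtr0_norm //; exact: is_derive1_powR.
  apply: near_eq_is_derive h.
  by near=> y; rewrite gtr0_norm //; near: y; exact: lt_nbhsr.
- have h : is_derive x 1 ((@powR R ^~ p) \o -%R) (p * spow x).
    have nx : 0 < - x by rewrite oppr_gt0.
    have h := is_derive1_powR p nx.
    apply: is_derive_eq.
    by rewrite /spow ltr0_sg // ltr0_norm // mulN1r mulrN1 mulrN.
  apply: near_eq_is_derive h.
  by near=> y; rewrite /= ltr0_norm //; near: y; exact: lt_nbhsl.
(* At 0 the difference quotient of |z|^p is [spow] z, whose modulus |z|^(p-1) tends to 0 because p >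
   1. *)
- rewrite spow0 mulr0.
  have h : h^-1 *: (`|h *: (1 : R) + 0| `^ p - `|0 : R| `^ p) @[h --> (0 : R)^'] --> (0 : R).
    apply/cvgr0Pnorm_lt => e e0.
    have /cvgr0_norm_lt /(_ e e0) hq := cvg_norm_powR0 p1_gt0.
    near=> z.
    have z0 : z != 0 by near: z; exact: nbhs_dnbhs_neq.
    rewrite normr0 powR0 ?gt_eqF // subr0 addr0 [_ *: 1]mulr1 -mul_spow.
    rewrite [_ *: _]mulrA mulVf // mul1r norm_spow -[X in X < _]ger0_norm ?powR_ge0 //.
    by near: z; apply: nbhs_dnbhs.
  by apply: DeriveDef; [apply/cvg_ex; exists 0|apply: cvg_lim].
Unshelve. all: by end_near. Qed.

Lemma continuous_spow : continuous spow.
Proof.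
move=> x; have [->|x0] := eqVneq x 0.
  rewrite /continuous_at spow0; apply/cvgr0Pnorm_lt => e e0.
  have /cvgr0_norm_lt /(_ e e0) := cvg_norm_powR0 p1_gt0.
  by apply: filterS => y; rewrite norm_spow ger0_norm ?powR_ge0.
(* Near a nonzero x, [spow] y is |y|^p / y, so continuity follows from the differentiability of
   |y|^p. *)
have c0 : {for x, continuous (fun y : R => `|y| `^ p)}.
  apply/differentiable_continuous/derivable1_diffP.
  by have [] := is_derive_norm_powR x.
have c : (fun y : R => `|y| `^ p * y^-1) y @[y --> x] --> `|x| `^ p * x^-1.
  by apply: cvgM; [exact: c0|apply: cvgV].
have nx : \forall y \near x, spow y = `|y| `^ p * y^-1.
  near=> y; have y0 : y != 0 by near: y; exact: cvgr_neq0 x0.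
  by rewrite -mul_spow mulrAC mulfV ?mul1r.
exact: near_eq_continuous nx c.
Unshelve. all: by end_near. Qed.

(** Young's inequality with exponents p / (p - 1) and p, applied to (|x| / a)^(p-1) and |y| / b. The
    bound is linear in |x|^p and |y|^p, so it can be summed and integrated before the scales a and b
    are chosen; this is how Hoelder's inequality enters. *)
Lemma young_spow (a b x y : R) : 0 < a -> 0 < b ->
  `|spow x * y| <= a `^ (p - 1) * b *
    ((1 - p^-1) * (`|x| `^ p / a `^ p) + p^-1 * (`|y| `^ p / b `^ p)).
Proof.
move=> a0 b0.
pose q := p / (p - 1).
have q0 : 0 < q by rewrite divr_gt0.
have qV : q^-1 = 1 - p^-1 by rewrite /q invf_div mulrBl mul1r mulfV ?gt_eqF.
have := @conjugate_powR R ((`|x| / a) `^ (p - 1)) (`|y| / b) q p.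
have aw := ltW a0; have bw := ltW b0.
rewrite powR_ge0 divr_ge0 // => /(_ isT isT q0 p_gt0).
rewrite qV subrK -powRrM (_ : (p - 1) * q = p) => [/(_ erefl)|]; last first.
  by rewrite mulrC divfK ?gt_eqF.
rewrite !powR_div // => h; rewrite [_ * (1 - _)]mulrC [_ / p]mulrC in h.
rewrite normrM norm_spow -ler_pdivrMl ?mulr_gt0 ?powR_gt0 //.
apply: le_trans h; rewrite le_eqVlt; apply/orP; left; apply/eqP.
by rewrite invfM mulrACA [_^-1 * _]mulrC [b^-1 * _]mulrC.
Qed.

End SignedPower.

(** * Psi in terms of Plucker coordinates *)

Section PsiFormula.
Variables (R : realType) (p : R).
Hypothesis p_gt1 : 1 < p.
Implicit Types (V : 'M[R]_(2, 4)) (T : Gr R) (X : 'M[R]_4).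

Let p_gt0 : 0 < p. Proof. by rewrite (lt_trans _ p_gt1). Qed.

(** The half undoes the double count of the pairs in an antisymmetric matrix: on a Plucker matrix
    this is the p-th power of the l^p norm of the 2-vector. *)
Definition psum X : R := (\sum_i \sum_j `|X i j| `^ p) / 2.

Lemma psum_ge0 X : 0 <= psum X.
Proof.
by rewrite divr_ge0 // sumr_ge0 // => i _; rewrite sumr_ge0 // => j _; rewrite powR_ge0.
Qed.

Lemma lp_normZ (c : R) x : 0 <= c -> lp_norm p (c *: x) = c * lp_norm p x.
Proof.
move=> c0; rewrite /lp_norm.
under eq_bigr => k _ do rewrite mxE normrM (ger0_norm c0) powRM //.
rewrite -mulr_sumr powRM ?powR_ge0 ?sumr_ge0 //.
by rewrite -powRrM mulfV ?gt_eqF // powRr1.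
Qed.

Lemma lp_normN x : lp_norm p (- x) = lp_norm p x.
Proof. by congr (_ `^ _); apply: eq_bigr => k _; rewrite mxE normrN. Qed.

Lemma lp_norm_wedge V : lp_norm p (wedge V) = psum (plucker V) `^ p^-1.
Proof.
rewrite /psum -(@sum_index_pairs _ (fun i j => `|plucker V i j| `^ p)).
- by congr (_ `^ _); apply: eq_bigr => k _; rewrite mxE wdot_basis_pair.
- by move=> i j; rewrite pluckerC normrN.
- by move=> i; rewrite plucker_diag normr0 powR0 ?gt_eqF.
Qed.

(** Covers frames that are not orthonormal, such as those met along the curves of planes below. *)
Lemma Psi_gram T V (K : 'M[R]_2) :
  V *m V^T *m K = 1%:M -> V^T *m K *m V = val T ->
  Psi (lp_norm p) T = (wnorm V)^-1 * psum (plucker V) `^ p^-1.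
Proof.
move=> VK KT; have oV : orth_proj V = val T by rewrite (orth_proj_gram VK).
rewrite (PsiE lp_normN (row_free_gram VK) oV).
by rewrite lp_normZ ?invr_ge0 ?sqrtr_ge0 // lp_norm_wedge.
Qed.

Lemma Psi_frame T V : V *m V^T = 1%:M -> V^T *m V = val T ->
  Psi (lp_norm p) T = psum (plucker V) `^ p^-1.
Proof.
move=> VV VT; rewrite (@Psi_gram T V 1%:M) ?VV ?mulmx1 //.
by rewrite /wnorm /wdot VV det1 sqrtr1 invr1 mul1r.
Qed.

(* The 2x2 minors of a projection determine its Plucker coordinates up to a
   common sign. *)
Lemma gram_minor V (i j k l : 'I_4) :
  (V^T *m V) i k * (V^T *m V) j l - (V^T *m V) i l * (V^T *m V) j k =
  plucker V i j * plucker V k l.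
Proof.
rewrite !mxE !big_ord_recl !big_ord0 !mxE.
have -> : lift ord0 ord0 = 1 :> 'I_2 by apply/val_inj.
by ring.
Qed.

(** By [gram_minor] the squares are the principal 2x2 minors of P, and these add up to (tr P)^2 - tr
    (P^2) = 4 - 2. *)
Lemma sum_sqr_plucker V : V *m V^T = 1%:M ->
  \sum_i \sum_j plucker V i j ^+ 2 = 2.
Proof.
move=> VV; pose P := V^T *m V.
have trP : \tr P = 2 by rewrite mxtrace_mulC VV mxtrace1.
have PT : P^T = P by rewrite trmx_mul trmxK.
have PP : P *m P = P by rewrite /P mulmxA -(mulmxA V^T) VV mulmx1.
transitivity (\tr P * \tr P - \tr (P *m P)); last by rewrite PP trP; ring.
rewrite mulr_suml -sumrB; apply: eq_bigr => i _.
rewrite mulr_sumr [(P *m P) i i]mxE -sumrB; apply: eq_bigr => j _.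
by rewrite expr2 -gram_minor -/P.
Qed.

Lemma psum_gt0 V : V *m V^T = 1%:M -> 0 < psum (plucker V).
Proof.
move=> VV; rewrite lt0r psum_ge0 andbT; apply/eqP => h.
have := sum_sqr_plucker VV; rewrite big1 => [/eqP|i _]; first by rewrite eq_sym pnatr_eq0.
rewrite big1 // => j _.
have : \sum_i \sum_j `|plucker V i j| `^ p = 0 by rewrite /psum in h; lra.
move/psumr_eq0P => /(_ _ i isT); rewrite -/(plucker V).
move/(_ (fun i _ => sumr_ge0 _ (fun j _ => powR_ge0 _ _)))/psumr_eq0P.
move/(_ (fun j _ => powR_ge0 _ _) j isT)/powR_eq0_eq0/eqP.
by rewrite normr_eq0 => /eqP ->; rewrite expr0n.
Qed.

Lemma Psi_gt0 T : 0 < Psi (lp_norm p) T.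
Proof.
have [V VV VT] := orthonormal_frame T.
by rewrite (Psi_frame VV VT) powR_gt0 // psum_gt0.
Qed.

(* The gradient of [psum] at X is [p / 2 *: smx X]. *)
Definition smx X : 'M[R]_4 := map_mx (spow p) X.

(** This is the component of B along P. With J the quarter turn, X = V^T J V; the 2x2 matrix V S V^T
    is antisymmetric, hence a multiple of J, and J J^T = 1. *)
Lemma plucker_smx V : V *m V^T = 1%:M ->
  V^T *m V *m smx (plucker V) *m (plucker V)^T = psum (plucker V) *: (V^T *m V).
Proof.
move=> VV; set X := plucker V; set S := smx X.
pose J : 'M[R]_2 := \matrix_(r, s) (if r == s then 0 else if r == 0 then 1 else -1).
have XE : X = V^T *m J *m V.
  apply/matrixP => i j; rewrite !mxE !big_ord_recl !big_ord0 !mxE !big_ord_recl !big_ord0 !mxE.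
  have -> : lift ord0 ord0 = 1 :> 'I_2 by apply/val_inj.
  by rewrite /=; ring.
have JJ : J *m J^T = 1%:M.
  apply/matrixP => r s; rewrite !mxE !big_ord_recl big_ord0 !mxE.
  have -> : lift ord0 ord0 = 1 :> 'I_2 by apply/val_inj.
  by case: r => [[|[|//]] ?]; case: s => [[|[|//]] ?] /=; ring.
have ST : S^T = - S by apply/matrixP => i j; rewrite mxE mxE pluckerC spowN !mxE.
have AT : (V *m S *m V^T)^T = - (V *m S *m V^T).
  by rewrite !trmx_mul trmxK ST mulNmx mulmxN mulmxA.
have A01 : (V *m S *m V^T) 0 1 = psum X.
  (* The multiple of J is found by pairing S with X, where S_ij X_ij = |X_ij|^p; antisymmetry then
     halves the sum. *)
  have : (V *m S *m V^T) 0 1 - (V *m S *m V^T) 1 0 = \sum_i \sum_j `|X i j| `^ p.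
    rewrite -!mulmxA !mxE -sumrB; apply: eq_bigr => i _.
    rewrite !mxE !mulr_sumr -sumrB; apply: eq_bigr => j _.
    by rewrite -(mul_spow p_gt1) /S /X !mxE; ring.
  move/matrixP/(_ 0 1): AT; rewrite mxE [in RHS]mxE /psum; lra.
have AE : V *m S *m V^T = psum X *: J.
  have A00 : forall r, (V *m S *m V^T) r r = 0.
    by move=> r; move/matrixP/(_ r r): AT; rewrite mxE [in RHS]mxE; lra.
  have A10 : (V *m S *m V^T) 1 0 = - psum X.
    by move/matrixP/(_ 0 1): AT; rewrite mxE [in RHS]mxE A01.
  have ord2 (r : 'I_2) : r = 0 \/ r = 1.
    by case: r => [[|[|//]] hr]; [left|right]; apply/val_inj.
  apply/matrixP => r s; rewrite [RHS]mxE [J r s]mxE.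
  have [->|->] := ord2 r; have [->|->] := ord2 s;
    by rewrite /= ?A00 ?A01 ?A10 ?mulr0 ?mulr1 ?mulrN1.
rewrite [in X^T]XE !trmx_mul trmxK !mulmxA -(mulmxA V^T) -(mulmxA V^T) AE.
by rewrite -scalemxAr -!scalemxAl -(mulmxA V^T) JJ mulmx1.
Qed.

End PsiFormula.

(** * The differential of Psi *)

(** Reads off the velocity of a curve without differentiating its second-order remainder: at 0 the
    product rule multiplies both g(0) and the derivative of g by zero. *)
Lemma is_derive_taylor1 {R : realType} (a b : R) (g : R -> R) :
  derivable g 0 1 -> is_derive (0 : R) 1 (fun t => a + t * b + t ^+ 2 * g t) b.
Proof.
move=> dg; have hg : is_derive (0 : R) 1 g ('D_1 g 0) by exact: derivableP.
have hid : is_derive (0 : R) 1 (@id R) 1 by exact: is_derive_id.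
have hc k : is_derive (0 : R) 1 (cst k : R -> R) 0 by exact: is_derive_cst.
have h0 := is_deriveD (is_deriveD (hc a) (is_deriveM hid (hc b)))
  (is_deriveM (is_deriveM hid hid) hg).
have h : is_derive (0 : R) 1 (cst a + id * cst b + (id * id) * g) b.
  apply: is_derive_eq h0 _.
  by rewrite /GRing.scale /= [(id * id) 0]mul0r !mul0r mulr1 !addr0 mulr0 !add0r addr0.
by apply: near_eq_is_derive h; near=> t; rewrite /= expr2.
Unshelve. all: by end_near. Qed.

Lemma is_derive_quadratic {R : realType} (a b c : R) :
  is_derive (0 : R) 1 (fun t => a + t * b + t ^+ 2 * c) b.
Proof. exact: (@is_derive_taylor1 R a b (cst c)). Qed.

Section Curve.
Variables (R : realType) (p : R).
Hypothesis p_gt1 : 1 < p.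

Lemma is_derive_psum (X Y : 'M[R]_4) :
  is_derive (0 : R) 1 (fun t : R => psum p (X + t *: Y))
    (p * ((\sum_i \sum_j spow p (X i j) * Y i j) / 2)).
Proof.
have hij i j : is_derive (0 : R) 1 (fun t : R => `|(X + t *: Y) i j| `^ p)
    (p * (spow p (X i j) * Y i j)).
  have h1 : is_derive (0 : R) 1 (fun t : R => X i j + t * Y i j + t ^+ 2 * 0) (Y i j).
    exact: is_derive_quadratic.
  have h0 : X i j + 0 * Y i j + 0 ^+ 2 * 0 = X i j.
    by rewrite mul0r mulr0 !addr0.
  have h2 := is_derive_norm_powR p_gt1 (X i j).
  rewrite -[X in is_derive X]h0 in h2.
  have h := @is_derive1_comp R (fun y => `|y| `^ p)
    (fun t => X i j + t * Y i j + t ^+ 2 * 0) _ _ _ h2 h1.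
  rewrite -mulrA in h.
  by apply: near_eq_is_derive h; near=> t; rewrite /= !mxE mulr0 addr0.
have hs : is_derive (0 : R) 1
    (2^-1 \*: \sum_i \sum_j (fun t : R => `|(X + t *: Y) i j| `^ p))
    (2^-1 *: \sum_i \sum_j (p * (spow p (X i j) * Y i j))).
  apply: is_deriveZ; apply: is_derive_sum => i; exact: is_derive_sum.
rewrite (_ : p * _ = 2^-1 *: \sum_i \sum_j (p * (spow p (X i j) * Y i j))).
  apply: near_eq_is_derive hs; near=> t.
  rewrite /psum [RHS]mulrC /=; congr (2^-1 *: _); rewrite fct_sumE; apply: eq_bigr => i _.
  by rewrite fct_sumE.
rewrite mulrA /GRing.scale /= [RHS]mulrC; congr (_ / _); rewrite mulr_sumr.
by apply: eq_bigr => i _; rewrite mulr_sumr.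
Unshelve. all: by end_near. Qed.

End Curve.

Section Tangent.
Variables (R : realType) (p : R).
Hypothesis p_gt1 : 1 < p.
Let p_gt0 : 0 < p. Proof. by rewrite (lt_trans _ p_gt1). Qed.

Variables (V : 'M[R]_(2, 4)) (q : 'rV[R]_4) (c : 'cV[R]_2).
Hypothesis VV : V *m V^T = 1%:M.
Hypothesis Vq : V *m q^T = 0.

Let m : R := (c^T *m c) 0 0.
Let n : R := (q *m q^T) 0 0.
Let u : 'cV[R]_4 := V^T *m c.

(* The rows of [Vt t] span a curve of planes through the one spanned by V; as
   [c *m q] has rank one, its Plucker coordinates are affine in t, and [Kt t]
   below is the inverse of its Gram matrix by the Sherman-Morrison formula. *)
Let Vt (t : R) : 'M[R]_(2, 4) := V + t *: (c *m q).
Let den (t : R) : R := 1 + t ^+ 2 * (n * m).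
(** The projection onto the plane of [Vt t], expanded entrywise with everything beyond first order
    gathered under t^2, as [is_derive_taylor1] expects. *)
Let gam (t : R) : 'M[R]_4 :=
  \matrix_(k, l) ((V^T *m V) k l + t * (u k 0 * q 0 l + q 0 k * u l 0) +
    t ^+ 2 * (m * (q 0 k * q 0 l) -
              n * (u k 0 + t * (m * q 0 k)) * (u l 0 + t * (m * q 0 l)) / den t)).

Let qV : q *m V^T = 0.
Proof. by rewrite -[LHS]trmxK trmx_mul trmxK Vq trmx0. Qed.

Let n_ge0 : 0 <= n.
Proof. by rewrite /n mulmx_tr_diag sumr_ge0 // => k _; exact: sqr_ge0. Qed.

Let m_ge0 : 0 <= m.
Proof.
rewrite /m -{2}[c]trmxK mulmx_tr_diag sumr_ge0 // => k _; exact: sqr_ge0.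
Qed.

Let den_gt0 t : 0 < den t.
Proof. by rewrite ltr_wpDr // mulr_ge0 ?sqr_ge0 // mulr_ge0. Qed.

Let Vt_gram t : Vt t *m (Vt t)^T = 1%:M + (t ^+ 2 * n) *: (c *m c^T).
Proof.
rewrite /Vt linearD linearZ /= trmx_mul mulmxDl !mulmxDr VV -!scalemxAl -!scalemxAr.
rewrite !mulmxA Vq mul0mx -(mulmxA c q) qV mulmx0 !scaler0 addr0 add0r.
rewrite -(mulmxA c) [q *m _]mx11_scalar -/n mul_mx_scalar -scalemxAl !scalerA.
by congr (_ + _ *: _); ring.
Qed.

Let Kt (t : R) : 'M[R]_2 := 1%:M - (t ^+ 2 * n / den t) *: (c *m c^T).

Let Kt_sym t : (Kt t)^T = Kt t.
Proof. by rewrite linearB linearZ /= trmx1 trmx_mul trmxK. Qed.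

Let Vt_K t : Vt t *m (Vt t)^T *m Kt t = 1%:M.
Proof.
have EE : (c *m c^T) *m (c *m c^T) = m *: (c *m c^T).
  rewrite mulmxA -(mulmxA c) [c^T *m c]mx11_scalar -/m mul_mx_scalar.
  by rewrite -scalemxAl.
rewrite Vt_gram /Kt; move: (c *m c^T) EE => E EE.
rewrite mulmxBr mulmx1 -scalemxAr mulmxDl mul1mx -scalemxAl EE -addrA.
rewrite scalerDr !scalerA -scalerDl -scalerBl.
rewrite (_ : _ - _ = 0) ?scale0r ?addr0 //.
rewrite /den; field; exact: lt0r_neq0 (den_gt0 t).
Qed.

Let Vt_det t : wnorm (Vt t) = Num.sqrt (den t).
Proof.
rewrite /wnorm /wdot Vt_gram det_mx22 !mxE !big_ord_recl !big_ord0 !mxE /den.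
congr (Num.sqrt _).
have -> : m = c 0 0 ^+ 2 + c 1 0 ^+ 2.
  rewrite /m mxE !big_ord_recl !big_ord0 !mxE.
  have -> : lift ord0 ord0 = 1 :> 'I_2 by apply/val_inj.
  by ring.
by rewrite /=; ring.
Qed.

Let gamE t : (Vt t)^T *m Kt t *m Vt t = gam t.
Proof.
have uc : c^T *m V = u^T by rewrite trmx_mul trmxK.
have Wc : (Vt t)^T *m c = u + (t * m) *: q^T.
  rewrite /Vt linearD linearZ /= trmx_mul mulmxDl -scalemxAl -mulmxA.
  by rewrite [c^T *m c]mx11_scalar -/m mul_mx_scalar scalerA.
have cW : c^T *m Vt t = u^T + (t * m) *: q.
  by rewrite -[LHS]trmxK trmx_mul trmxK Wc linearD linearZ /= trmxK.
have Wt : (Vt t)^T = V^T + t *: (q^T *m c^T) by rewrite linearD linearZ /= trmx_mul.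
have WW : (Vt t)^T *m Vt t =
    V^T *m V + t *: (u *m q + q^T *m u^T) + (t ^+ 2 * m) *: (q^T *m q).
  rewrite Wt /Vt mulmxDl !mulmxDr -!scalemxAl -!scalemxAr -(mulmxA q^T) uc.
  rewrite (mulmxA V^T) -/u -(mulmxA q^T) (mulmxA c^T) [c^T *m c]mx11_scalar -/m.
  by rewrite mul_scalar_mx -scalemxAr !scalerA scalerDr !addrA; congr (_ + _ *: _); ring.
rewrite /Kt mulmxBr mulmx1 mulmxBl -scalemxAr -scalemxAl WW.
rewrite mulmxA Wc -(mulmxA _ c^T) cW.
apply/matrixP => k l; rewrite /gam !mxE !big_ord1 !mxE.
by move: (den t)^-1 => d; ring.
Qed.

Let X : 'M[R]_4 := plucker V.
(** [w] is [u] turned by a right angle inside the plane of V, and [Y], the Plucker matrix of the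
    pair q, w, is the velocity of the Plucker matrix. *)
Let w (l : 'I_4) : R := c 0 0 * V 1 l - c 1 0 * V 0 l.
Let Y : 'M[R]_4 := \matrix_(k, l) (q 0 k * w l - q 0 l * w k).

Let plucker_Vt t : plucker (Vt t) = X + t *: Y.
Proof. by apply/matrixP => k l; rewrite !mxE !big_ord1 /w; ring. Qed.

Let is_derive_gam_entry k l :
  is_derive (0 : R) 1 (fun t => gam t k l) (u k 0 * q 0 l + q 0 k * u l 0).
Proof.
pose lin (k : 'I_4) (t : R) := u k 0 + t * (m * q 0 k) + t ^+ 2 * 0.
have dlin k' : derivable (lin k') 0 1.
  by have [] := is_derive_quadratic (u k' 0) (m * q 0 k') 0.
(* The null linear term makes the denominator fit [is_derive_quadratic]; its value 1 at t = 0 makes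
   the inverse derivable there. *)
have dden : derivable (fun t : R => 1 + t * 0 + t ^+ 2 * (n * m)) 0 1.
  by have [] := is_derive_quadratic 1 0 (n * m).
have dg : derivable (cst (m * (q 0 k * q 0 l)) - cst n * lin k * lin l *
    (fun t : R => (1 + t * 0 + t ^+ 2 * (n * m))^-1)) 0 1.
  have dinv : derivable (fun t : R => (1 + t * 0 + t ^+ 2 * (n * m))^-1) 0 1.
    by apply: derivableV dden; rewrite mulr0 addr0 expr0n mul0r addr0 oner_neq0.
  apply: derivableB; first exact: derivable_cst.
  apply: derivableM dinv; apply: derivableM (dlin l).
  by apply: derivableM (dlin k); exact: derivable_cst.
have h := is_derive_taylor1 ((V^T *m V) k l) (u k 0 * q 0 l + q 0 k * u l 0) dg.
apply: near_eq_is_derive h; near=> t.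
rewrite [X in _ + _ ^+ 2 * X](_ : _ = m * (q 0 k * q 0 l) -
  n * lin k t * lin l t * (1 + t * 0 + t ^+ 2 * (n * m))^-1) //.
by rewrite [RHS]mxE /lin /den !mulr0 !addr0.
Unshelve. all: by end_near. Qed.

(** The curve [gam] stays in the Grassmannian, where F is Psi, so the chain rule along it fixes the
    differential in its direction at t = 0 whatever the extension. *)
Lemma diff_Psi_tangent (F : 'M[R]_4 -> R) (T : Gr R) :
  C1_extension (Psi (lp_norm p)) F -> V^T *m V = val T ->
  'd F (val T) (u *m q + (u *m q)^T) =
  psum p X `^ (p^-1 - 1) * ((\sum_k \sum_l spow p (X k l) * Y k l) / 2).
Proof.
move=> [FE [U [oU GU [dF _]]]] VT.
have FT t : F (gam t) = (Num.sqrt (den t))^-1 * psum p (X + t *: Y) `^ p^-1.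
  pose T' : Gr R := exist (fun M => is_true (M \in @G42 R)) _ (G42_gram (Vt_K t) (Kt_sym t)).
  have T'E : (Vt t)^T *m Kt t *m Vt t = val T' by [].
  transitivity (Psi (lp_norm p) T'); first by rewrite -(FE T') -gamE.
  by rewrite (Psi_gram p_gt1 (Vt_K t) T'E) Vt_det plucker_Vt.
have gam0 : gam 0 = val T.
  by rewrite -VT; apply/matrixP => k l; rewrite mxE expr0n /= !mul0r !addr0.
have dgam : derivable gam 0 1.
  by apply/derivable_mxP => k l; have [] := is_derive_gam_entry k l.
have Dgam : 'D_1 gam 0 = u *m q + (u *m q)^T.
  rewrite derive_mx //; apply/matrixP => k l; rewrite !mxE !big_ord1.
  have [_ ->] := is_derive_gam_entry k l; rewrite !mxE; ring.
have dFT : differentiable F (gam 0).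
  by rewrite gam0; apply: dF; apply: GU; case: (T) => P /=; rewrite inE.
have dg : differentiable gam 0 by apply/derivable1_diffP.
rewrite -Dgam -gam0 deriveE //.
transitivity ('d (F \o gam) 0 1); first by rewrite (diff_comp dg dFT).
rewrite -deriveE; last exact: differentiable_comp.
have dpsum := is_derive_psum p_gt1 X Y.
have X0 : X + 0 *: Y = X by rewrite scale0r addr0.
have psum0 : 0 < psum p (X + 0 *: Y) by rewrite X0 psum_gt0.
have h1 := @is_derive1_comp R (@powR R ^~ p^-1) (fun t => psum p (X + t *: Y)) _ _ _
  (is_derive1_powR p^-1 psum0) dpsum.
(* The normalisation [den]^(-1/2) is stationary at t = 0, since [den] has no linear term; only the
   derivative of [psum] survives. *)
have dd := is_derive_quadratic 1 0 (n * m).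
have d0 : 0 < (1 + 0 * 0 + 0 ^+ 2 * (n * m) : R).
  by rewrite mulr0 addr0 expr0n mul0r addr0.
have h2 := @is_derive1_comp R (@powR R ^~ (- 2^-1))
  (fun t : R => 1 + t * 0 + t ^+ 2 * (n * m)) _ _ _
  (is_derive1_powR (- 2^-1) d0) dd.
have h3 := is_deriveM h2 h1.
have h : is_derive (0 : R) 1 (F \o gam)
   (psum p X `^ (p^-1 - 1) * ((\sum_k \sum_l spow p (X k l) * Y k l) / 2)).
  apply: is_derive_eq.
    apply: near_eq_is_derive h3; near=> t.
    transitivity ((1 + t * 0 + t ^+ 2 * (n * m)) `^ (- 2^-1) *
      psum p (X + t *: Y) `^ p^-1) => //.
    have dt := ltW (den_gt0 t); rewrite mulr0 addr0 -/(den t) powRN powR12_sqrt //.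
    by rewrite -FT.
  rewrite /= X0 !mulr0 scaler0 expr0n mul0r !addr0 powR1 /GRing.scale /= mul1r.
  by rewrite mulrACA mulVf ?gt_eqF // mul1r.
by have [_ ->] := h.
Unshelve. all: by end_near. Qed.

End Tangent.

(** * The closed formula for B *)

Section BFormula.
Variables (R : realType) (p : R).
Hypothesis p_gt1 : 1 < p.
Let p_gt0 : 0 < p. Proof. by rewrite (lt_trans _ p_gt1). Qed.

Lemma diff_grad (F : 'M[R]_4 -> R) (P : 'M[R]_4) (q : 'rV[R]_4) (u : 'cV[R]_4) :
  'd F P (u *m q + (u *m q)^T) = (q *m (grad F P + (grad F P)^T) *m u) 0 0.
Proof.
have dE H : 'd F P H = \sum_k \sum_l H k l * grad F P k l.
  rewrite {1}(matrix_sum_delta H) linear_sum; apply: eq_bigr => k _.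
  rewrite linear_sum; apply: eq_bigr => l _.
  by rewrite linearZ /= mxE.
rewrite -mulmxA mulmxDl mulmxDr [RHS]mxE !mulmxA dE.
have e : (q *m (grad F P)^T *m u) 0 0 = (u^T *m grad F P *m q^T) 0 0.
  transitivity ((q *m (grad F P)^T *m u)^T 0 0); first by rewrite [RHS]mxE.
  by rewrite !trmx_mul trmxK mulmxA.
rewrite e -!mulmxA !mxE addrC -big_split; apply: eq_bigr => k _ /=.
rewrite !mxE !mulr_sumr -big_split; apply: eq_bigr => l _ /=.
by rewrite !mxE !big_ord1; ring.
Qed.

(** The right-hand side splits along P and 1 - P. Its P part is Psi P by [plucker_smx]; its other
    part is matched entrywise with the differential in tangent directions. *)
Lemma Bmx_frame (F : 'M[R]_4 -> R) (T : Gr R) (V : 'M[R]_(2, 4)) :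
  C1_extension (Psi (lp_norm p)) F -> V *m V^T = 1%:M -> V^T *m V = val T ->
  Bmx (Psi (lp_norm p)) F T =
  psum p (plucker V) `^ (p^-1 - 1) *: (smx p (plucker V) *m (plucker V)^T).
Proof.
move=> FE VV VT; set X := plucker V; set S := smx p X.
have key := plucker_smx p_gt1 VV; rewrite -/X -/S VT in key.
rewrite /Bmx (Psi_frame p_gt1 VV VT) -/X; set P := val T in VT key *.
set N := psum p X in key *; have N0 : 0 < N := psum_gt0 p VV.
have NE : N `^ p^-1 = N `^ (p^-1 - 1) * N.
  by rewrite mulrC mulr_powRB1 ?invr_gt0 ?(ltW N0).
suff -> : (1%:M - P) *m (grad F P + (grad F P)^T) *m P =
    N `^ (p^-1 - 1) *: ((1%:M - P) *m S *m X^T).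
  rewrite NE -scalerA -scalerDr 2!mulmxBl mul1mx key; congr (_ *: _).
  by rewrite addrC subrK.
apply/matrixP => i j.
(* With this choice u = V^T c is column j of P, and the vector w of the tangent computation is row j
   of X. *)
pose q : 'rV[R]_4 := row i (1%:M - P); pose c : 'cV[R]_2 := col j V.
have Vq : V *m q^T = 0.
  have -> : q^T = col i (1%:M - P).
    by rewrite tr_row linearB /= trmx1 -VT trmx_mul trmxK.
  by rewrite colE mulmxA mulmxBr mulmx1 -VT mulmxA VV mul1mx subrr mul0mx.
have := diff_Psi_tangent p_gt1 c VV Vq FE VT.
have -> : V^T *m c = col j P by rewrite -VT /c !colE mulmxA.
rewrite diff_grad -/P.
have -> : (q *m (grad F P + (grad F P)^T) *m col j P) 0 0 =
    ((1%:M - P) *m (grad F P + (grad F P)^T) *m P) i j.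
  by rewrite /q -row_mul !mxE; apply: eq_bigr => k _; rewrite !mxE.
move=> ->; rewrite [RHS]mxE; congr (_ * _).
have -> : ((1%:M - P) *m S *m X^T) i j = \sum_k \sum_l S k l * q 0 k * X j l.
  rewrite -mulmxA mxE; apply: eq_bigr => k _; rewrite [(S *m _) k j]mxE mulr_sumr.
  by apply: eq_bigr => l _; rewrite [X^T l j]mxE [q 0 k]mxE; ring.
have SC k l : S k l = - S l k by rewrite /S /smx mxE [(map_mx _ X) l k]mxE pluckerC spowN.
set A := \sum_k \sum_l S k l * q 0 k * X j l.
(* Exchanging k and l and using the antisymmetry of S, the two halves of the pairing with Y both
   equal A, which cancels the factor 1/2. *)
have AC : A = - \sum_k \sum_l S k l * q 0 l * X j k.
  rewrite exchange_big /= -sumrN; apply: eq_bigr => k _.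
  by rewrite -sumrN; apply: eq_bigr => l _; rewrite SC; ring.
suff : \sum_k \sum_l S k l * (q 0 k * X j l - q 0 l * X j k) = A + A.
  move=> AA; transitivity ((A + A) / 2); last by lra.
  rewrite -AA; congr (_ / _); apply: eq_bigr => k _; apply: eq_bigr => l _.
  by rewrite /S [smx p X k l]mxE !mxE; ring.
rewrite {2}AC -sumrB; apply: eq_bigr => k _; rewrite -sumrB; apply: eq_bigr => l _.
ring.
Qed.

End BFormula.

(** * A C^1 extension of Psi *)

Section C1Closure.
Variables (R : realType) (U : set 'M[R]_4).
Hypothesis U_open : open U.
Implicit Types F G : 'M[R]_4 -> R.

Lemma C1_on_intro F (DF : 'M[R]_4 -> 'M[R]_4 -> R) :
  (forall X, U X -> differentiable F X) ->
  (forall H X, U X -> 'd F X H = DF H X) ->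
  (forall H X, U X -> {for X, continuous (DF H)}) -> C1_on U F.
Proof.
move=> dF DE DC; split=> // H X UX.
have nU : \forall Y \near X, 'd F Y H = DF H Y.
  by apply: filterS (open_nbhs_nbhs (conj U_open UX)) => Y UY; exact: DE.
exact: (near_eq_continuous nU (DC H X UX)).
Qed.

Lemma C1_on_continuous F X : C1_on U F -> U X -> {for X, continuous F}.
Proof. by move=> [dF _] UX; apply/differentiable_continuous/dF. Qed.

Lemma C1_on_coord i j : C1_on U (fun M => M i j).
Proof.
apply: (@C1_on_intro _ (fun H _ => H i j)).
- by move=> X _; exact: differentiable_coord.
- move=> H X _; rewrite -deriveE; last exact: differentiable_coord.
  have h := @derive_mx R _ _ _ (@id 'M[R]_4) X H (@derivable_id R _ X H).
  rewrite derive_id in h.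
  by move/matrixP/(_ i j): h; rewrite [RHS]mxE => ->.
- by move=> H X _; exact: cst_continuous.
Qed.

Lemma C1_onB F G : C1_on U F -> C1_on U G -> C1_on U (fun M => F M - G M).
Proof.
move=> CF CG; have [dF DF] := CF; have [dG DG] := CG.
apply: (@C1_on_intro _ (fun H X => 'd F X H - 'd G X H)).
- by move=> X UX; apply: (@differentiableB _ _ _ F G); [exact: dF|exact: dG].
- move=> H X UX; have := @diffB _ _ _ F G X (dF X UX) (dG X UX).
  by move/(congr1 (fun f => f H)).
- by move=> H X UX; exact: (continuousB (DF H X UX) (DG H X UX)).
Qed.

Lemma C1_onD F G : C1_on U F -> C1_on U G -> C1_on U (fun M => F M + G M).
Proof.
move=> CF CG; have [dF DF] := CF; have [dG DG] := CG.
apply: (@C1_on_intro _ (fun H X => 'd F X H + 'd G X H)).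
- by move=> X UX; apply: (@differentiableD _ _ _ F G); [exact: dF|exact: dG].
- move=> H X UX; have := @diffD _ _ _ F G X (dF X UX) (dG X UX).
  by move/(congr1 (fun f => f H)).
- by move=> H X UX; exact: (continuousD (DF H X UX) (DG H X UX)).
Qed.

Lemma C1_onM F G : C1_on U F -> C1_on U G -> C1_on U (fun M => F M * G M).
Proof.
move=> CF CG; have [dF DF] := CF; have [dG DG] := CG.
apply: (@C1_on_intro _ (fun H X => F X * 'd G X H + G X * 'd F X H)).
- by move=> X UX; apply: (@differentiableM _ _ F G); [exact: dF|exact: dG].
- move=> H X UX; have := @diffM _ _ F G X (dF X UX) (dG X UX).
  by move/(congr1 (fun f => f H)).
- move=> H X UX; have cF := C1_on_continuous CF UX; have cG := C1_on_continuous CG UX.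
  exact: (continuousD (continuousM cF (DG H X UX)) (continuousM cG (DF H X UX))).
Qed.

Lemma C1_on_cst (a : R) : C1_on U (fun=> a).
Proof.
apply: (@C1_on_intro _ (fun _ _ => 0)).
- by move=> X _; exact: differentiable_cst.
- move=> H X UX; have := @diff_cst _ 'M[R]_4 _ a X.
  by move/(congr1 (fun f => f H)).
- by move=> H X _; exact: cst_continuous.
Qed.

Lemma C1_on_sum (I : Type) (r : seq I) (F : I -> 'M[R]_4 -> R) :
  (forall i, C1_on U (F i)) -> C1_on U (fun M => \sum_(i <- r) F i M).
Proof.
move=> CF; elim: r => [|i r IH].
  by under eq_fun do rewrite big_nil; exact: C1_on_cst.
rewrite (_ : (fun M => _) = fun M => F i M + \sum_(j <- r) F j M).
  exact: (C1_onD (CF i) IH).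
by apply/funext => M; rewrite big_cons.
Qed.

(** The conditions on g bear only on values taken by F on U, which admits powers that are singular
    at 0. *)
Lemma C1_on_comp (g g' : R -> R) F : C1_on U F ->
  (forall X, U X -> is_derive (F X) 1 g (g' (F X))) ->
  (forall X, U X -> {for F X, continuous g'}) -> C1_on U (fun M => g (F M)).
Proof.
move=> CF gd g'c; have [dF DF] := CF.
have dg X : U X -> differentiable g (F X).
  by move=> /gd [dg _]; apply/derivable1_diffP.
apply: (@C1_on_intro _ (fun H X => 'd F X H * g' (F X))).
- by move=> X UX; apply: (differentiable_comp (dF X UX) (dg X UX)).
- move=> H X UX; have := diff_comp (dF X UX) (dg X UX).
  move/(congr1 (fun f => f H)) => /= ->.
  rewrite diff1E; last exact: dg.
  by rewrite derive1E; have [_ ->] := gd X UX.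
- move=> H X UX; have cF := C1_on_continuous CF UX.
  exact: (continuousM (DF H X UX) (continuous_comp cF (g'c X UX))).
Qed.

End C1Closure.

Section C1Extension.
Variables (R : realType) (p : R).
Hypothesis p_gt1 : 1 < p.
Let p_gt0 : 0 < p. Proof. by rewrite (lt_trans _ p_gt1). Qed.

(* On a projection the minors are the products of two Plucker coordinates, so
   that this is the square of their p-th power sum; unlike the coordinates, the
   minors are polynomials on the whole matrix space. *)
Definition minor_psum (M : 'M[R]_4) : R :=
  \sum_i \sum_j \sum_k \sum_l `|M i k * M j l - M i l * M j k| `^ p.

Lemma C1_minor_psum (U : set 'M[R]_4) : open U -> C1_on U minor_psum.
Proof.
move=> oU; do 4 (apply: C1_on_sum => // ?).
apply: (@C1_on_comp _ _ oU (fun y => `|y| `^ p) (fun y => p * spow p y)).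
- by apply: C1_onB => //; apply: C1_onM => //; exact: C1_on_coord.
- by move=> X _; exact: is_derive_norm_powR.
- by move=> X _; apply: cvgM; [exact: cvg_cst|exact: continuous_spow].
Qed.

Lemma minor_psum_frame (V : 'M[R]_(2, 4)) :
  minor_psum (V^T *m V) = (psum p (plucker V) *+ 2) ^+ 2.
Proof.
have -> : psum p (plucker V) *+ 2 = \sum_i \sum_j `|plucker V i j| `^ p.
  by rewrite /psum mulr2n -splitr.
rewrite /minor_psum expr2 mulr_suml; apply: eq_bigr => i _.
rewrite mulr_suml; apply: eq_bigr => j _; rewrite mulr_sumr; apply: eq_bigr => k _.
rewrite mulr_sumr; apply: eq_bigr => l _.
by rewrite gram_minor normrM powRM.
Qed.

Lemma C1_Psi : C1_Gr (Psi (lp_norm p)).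
Proof.
(* On a projection [minor_psum] is (2N)^2 with N the p-th power sum, hence the division by 4 and the
   exponent 1/(2p) that return N^(1/p). *)
exists (fun M => (minor_psum M / 4) `^ (p^-1 / 2)); split.
  move=> T; have [V VV VT] := orthonormal_frame T.
  rewrite (Psi_frame p_gt1 VV VT) -VT minor_psum_frame.
  set N := psum p _; have N0 : 0 <= N := psum_ge0 p _.
  have -> : (N *+ 2) ^+ 2 / 4 = N `^ 2%:R.
    by rewrite powR_mulrn // mulr2n; field.
  by rewrite -powRrM mulrCA mulfV ?mulr1 ?pnatr_eq0.
(* The outer power is smooth where its argument is positive, which holds on the Grassmannian because
   N > 0. *)
pose U := minor_psum @^-1` [set x | 0 < x].
have oU : open U.
  apply: open_comp; last exact: open_gt.
  by move=> X _; apply: (C1_on_continuous (C1_minor_psum openT)).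
exists U; split => //.
  move=> P GP; have [V VV VT] := orthonormal_frame (exist _ P (mem_set GP) : Gr R).
  rewrite /U /= -[P]/(val (exist _ P (mem_set GP) : Gr R)) -VT minor_psum_frame.
  by rewrite exprn_gt0 // mulrn_wgt0 // psum_gt0.
apply: (@C1_on_comp _ _ oU (fun y => (y / 4) `^ (p^-1 / 2))
  (fun y => (p^-1 / 2) * (y / 4) `^ (p^-1 / 2 - 1) * 4^-1)).
- exact: C1_minor_psum.
- move=> X UX; have x4 : 0 < minor_psum X / 4 by rewrite divr_gt0.
  have h2 : is_derive (minor_psum X) 1 (fun y : R => y / 4) (4^-1).
    by apply: is_derive_eq; rewrite ?scaler0 ?add0r /GRing.scale /= ?mulr1.
  exact: (@is_derive1_comp R (@powR R ^~ (p^-1 / 2)) (fun y => y / 4) _ _ _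
    (is_derive1_powR (p^-1 / 2) x4) h2).
- move=> X UX; have x4 : 0 < minor_psum X / 4 by rewrite divr_gt0.
  have c4 : {for minor_psum X, continuous (fun y : R => y / 4)}.
    by apply: cvgM; [exact: cvg_id|exact: cvg_cst].
  apply: cvgM; last exact: cvg_cst.
  apply: cvgM; first exact: cvg_cst.
  apply: (@continuous_comp _ _ _ (fun y : R => y / 4) (@powR R ^~ (p^-1 / 2 - 1))) => //.
  apply/differentiable_continuous/derivable1_diffP.
  by have [] := is_derive1_powR (p^-1 / 2 - 1) x4.
Qed.

End C1Extension.

(** * Averages over a probability measure *)

(** The left side is 1 - ((1 - w) s / y + w s / z). This is where strictness in the final bound
    comes from. *)
Lemma convex_comb_lt1 (K : realFieldType) (w y z s : K) :
  0 < w < 1 -> 0 < y -> 0 < z -> 0 < s ->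
  (1 - w) * ((y - s) / y) + w * ((z - s) / z) < 1.
Proof.
move=> /andP[w0 w1] y0 z0 s0.
rewrite !mulrBl !divff ?gt_eqF //.
have := mulr_gt0 w0 (divr_gt0 s0 z0).
have : 0 < (1 - w) * (s / y) by rewrite mulr_gt0 ?divr_gt0 // subr_gt0.
by move: (s / y) (s / z) => u v; lra.
Qed.

(* The choice a^p = A, b^p = D turns the two bounds into |x| < a^(p-1) b and
   |y| < b^(p-1) a. *)
Lemma young_minor_neq (R : realType) (p A D s x y : R) :
  1 < p -> 0 < A -> 0 < D -> 0 < s ->
  (forall a b, 0 < a -> 0 < b -> `|x| <= a `^ (p - 1) * b *
     ((1 - p^-1) * ((A - s) / a `^ p) + p^-1 * ((D - s) / b `^ p))) ->
  (forall a b, 0 < a -> 0 < b -> `|y| <= a `^ (p - 1) * b *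
     ((1 - p^-1) * ((D - s) / a `^ p) + p^-1 * ((A - s) / b `^ p))) ->
  A * D != x * y.
Proof.
move=> p_gt1 A0 D0 s0 hx hy; have p_gt0 : 0 < p by rewrite (lt_trans _ p_gt1).
pose a := A `^ p^-1; pose b := D `^ p^-1.
have a0 : 0 < a by exact: powR_gt0.
have b0 : 0 < b by exact: powR_gt0.
have ap : a `^ p = A by rewrite -powRrM mulVf ?gt_eqF // powRr1 // ltW.
have bp : b `^ p = D by rewrite -powRrM mulVf ?gt_eqF // powRr1 // ltW.
have pV : 0 < p^-1 < 1 by rewrite invr_gt0 p_gt0 invf_lt1.
have l1 : `|x| < a `^ (p - 1) * b.
  apply: le_lt_trans (hx a b a0 b0) _.
  by rewrite ap bp gtr_pMr ?convex_comb_lt1 // mulr_gt0 // powR_gt0.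
have l2 : `|y| < b `^ (p - 1) * a.
  apply: le_lt_trans (hy b a b0 a0) _.
  by rewrite ap bp gtr_pMr ?convex_comb_lt1 // mulr_gt0 // powR_gt0.
have AD : A * D = (a `^ (p - 1) * b) * (b `^ (p - 1) * a).
  rewrite -ap -bp -[in LHS](mulr_powRB1 (ltW a0) p_gt0).
  by rewrite -[in LHS](mulr_powRB1 (ltW b0) p_gt0) [a * _]mulrC mulrACA [a * _]mulrC.
apply: contraTneq (ltr_pM (normr_ge0 _) (normr_ge0 _) l1 l2) => e.
by rewrite -normrM -e -AD ger0_norm ?ltxx // mulr_ge0 // ltW.
Qed.

Section RankTwo.
Context d (T : measurableType d) (R : realType).
Variables (mu : probability T R) (p : R) (n : nat) (B t : 'I_n -> 'I_n -> T -> R).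
Hypothesis p_gt1 : 1 < p.
Hypothesis B_int : forall i j, mu.-integrable setT (EFin \o B i j).
Hypothesis t_int : forall i j, mu.-integrable setT (EFin \o t i j).
Hypothesis t_ge0 : forall i j x, 0 <= t i j x.
Hypothesis t_sym : forall i j x, t j i x = t i j x.
Hypothesis t_diag : forall i x, t i i x = 0.
Hypothesis B_diag : forall i x, B i i x = \sum_k t i k x.
Hypothesis B_young : forall i j x (a b : R), i != j -> 0 < a -> 0 < b ->
  `|B i j x| <= a `^ (p - 1) * b * ((1 - p^-1) * ((B i i x - t i j x) / a `^ p) +
                                    p^-1 * ((B j j x - t i j x) / b `^ p)).
Hypothesis t_lower : exists2 c : R, 0 < c & forall x, c <= \sum_i \sum_j t i j x.

Let p_gt0 : 0 < p. Proof. by rewrite (lt_trans _ p_gt1). Qed.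

Let E (f : T -> R) : R := \int[mu]_x f x.

Let integrable_comb (a b : R) (f g : T -> R) :
  mu.-integrable setT (EFin \o f) -> mu.-integrable setT (EFin \o g) ->
  mu.-integrable setT (EFin \o (fun x => a * f x + b * g x)).
Proof.
move=> mf mg.
have := integrableD measurableT (integrableZl measurableT a mf) (integrableZl measurableT b mg).
exact.
Qed.

Let E_comb (a b : R) (f g : T -> R) :
  mu.-integrable setT (EFin \o f) -> mu.-integrable setT (EFin \o g) ->
  E (fun x => a * f x + b * g x) = a * E f + b * E g.
Proof.
move=> mf mg; rewrite /E RintegralD //; last 2 first.
  exact: (integrableZl measurableT a mf).
  exact: (integrableZl measurableT b mg).
by rewrite !RintegralZl.
Qed.

Let integrable_diff i j k l : mu.-integrable setT (EFin \o (fun x => B i j x - t k l x)).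
Proof. exact: (integrableB measurableT (B_int i j) (t_int k l)). Qed.

(** For fixed a and b the pointwise bound is linear in the diagonal entries and in t, so it passes
    to the means. *)
Let E_young i j (a b : R) : i != j -> 0 < a -> 0 < b ->
  `|E (B i j)| <= a `^ (p - 1) * b * ((1 - p^-1) * ((E (B i i) - E (t i j)) / a `^ p) +
                                      p^-1 * ((E (B j j) - E (t i j)) / b `^ p)).
Proof.
move=> ij a0 b0.
pose c1 := a `^ (p - 1) * b * (1 - p^-1) / a `^ p.
pose c2 := a `^ (p - 1) * b * p^-1 / b `^ p.
have c12 y z : a `^ (p - 1) * b * ((1 - p^-1) * (y / a `^ p) + p^-1 * (z / b `^ p)) =
  c1 * y + c2 * z by rewrite /c1 /c2; ring.
rewrite c12 -!RintegralB // -E_comb //.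
apply: le_trans (le_normr_Rintegral measurableT (B_int i j)) _.
apply: le_Rintegral => //.
- exact: (integrable_norm (B_int i j)).
- exact: integrable_comb.
- by move=> x _; rewrite -c12; exact: B_young.
Qed.

(** Some t_ij has positive mean; it is dominated by the means of both B_ii and B_jj, so
    [young_minor_neq] applies with it as s. *)
Lemma exists_minor_neq0 : exists i j : 'I_n,
  E (B i i) * E (B j j) != E (B i j) * E (B j i).
Proof.
have [c c0 tc] := t_lower.
(* Otherwise all means of the nonnegative t_ij vanish, and so does the mean of their sum, which is
   at least c. *)
have [[i j] /= tij] : exists ij : 'I_n * 'I_n, 0 < E (t ij.1 ij.2).
  apply/existsP; apply: contraPT c0 => /existsPn h; apply/negP; rewrite -leNgt.
  have Et0 i j : E (t i j) = 0.
    have := h (i, j); rewrite -leNgt /= => h1; apply/eqP; rewrite eq_le h1.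
    by apply: Rintegral_ge0.
  have sumI (I : Type) (r : seq I) (f : I -> T -> R) :
      (forall k, mu.-integrable setT (EFin \o f k) /\ E (f k) = 0) ->
      mu.-integrable setT (EFin \o (fun x => \sum_(k <- r) f k x)) /\
      E (fun x => \sum_(k <- r) f k x) = 0.
    move=> hf; elim: r => [|k r [IH1 IH2]].
      have -> : (fun x => \sum_(k <- [::]) f k x) = cst 0.
        by apply/funext => x; rewrite big_nil.
      split; first exact: finite_measure_integrable_cst.
      by rewrite /E Rintegral_cst // mul0r.
    have -> : (fun x => \sum_(l <- k :: r) f l x) = fun x => 1 * f k x + 1 * \sum_(l <- r) f l x.
      by apply/funext => x; rewrite big_cons !mul1r.
    have [hk hk0] := hf k.
    by split; [exact: integrable_comb|rewrite E_comb // hk0 IH2 !mulr0 addr0].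
  have [hI <-] : mu.-integrable setT (EFin \o (fun x => \sum_i \sum_j t i j x)) /\
      E (fun x => \sum_i \sum_j t i j x) = 0.
    by apply: (sumI) => i; apply: (sumI) => j.
  have <- : E (cst c) = c.
    rewrite /E Rintegral_cst // -[RHS]mulr1; congr (_ * _).
    exact: (congr1 fine (probability_setT mu)).
  apply: le_Rintegral => //; exact: finite_measure_integrable_cst.
exists i, j.
have ij : i != j.
  apply: contraTneq tij => ->; rewrite -leNgt /E.
  by under eq_Rintegral do rewrite t_diag; rewrite Rintegral_cst // mul0r.
have tE : E (t j i) = E (t i j) by congr E; apply/funext.
have Bt k l : E (t k l) <= E (B k k).
  apply: le_Rintegral => // x _.
  by rewrite B_diag (bigD1 l) //= lerDl sumr_ge0.
have A0 : 0 < E (B i i) := lt_le_trans tij (Bt i j).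
have D0 : 0 < E (B j j) by apply: lt_le_trans tij _; rewrite -tE.
have ji : j != i by rewrite eq_sym.
apply: (young_minor_neq p_gt1 A0 D0 tij) => a b a0 b0; first exact: E_young.
by rewrite -tE; exact: E_young.
Qed.

End RankTwo.

(** * Borel measurability on the Grassmannian *)

Section Measurability.
Variable R : realType.

(** The inclusion into the matrix space is continuous for the induced topology, so g restricts to a
    continuous map and preimages of open intervals are open, hence Borel. *)
Lemma measurable_Gr (g : 'M[R]_4 -> R) :
  (forall P, @G42 R P -> {for P, continuous g}) ->
  measurable_fun [set: GrBorel R] (fun T : GrBorel R => g (val (T : Gr R))).
Proof.
move=> cg.
have cT : continuous ((fun T : Gr R => g (val T)) : Gr R -> R).
  move=> T; apply: (@continuous_comp _ _ _ (fun T : Gr R => val T) g).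
    exact: (@initial_continuous (Gr R) _ (@set_val _ (@G42 R))).
  by apply: cg; case: T => P /=; rewrite inE.
apply: (measurability _ (RGenOpens.measurableE R)).
move=> _ [_ [a [b ->] <-]]; rewrite setTI.
apply: sub_sigma_algebra; move/continuousP: cT; apply; exact: interval_open.
Qed.

Lemma measurable_Gr_coord i j :
  measurable_fun [set: GrBorel R] (fun T : GrBorel R => val (T : Gr R) i j).
Proof. by apply: (@measurable_Gr (fun P => P i j)) => P _; exact: coord_continuous. Qed.

Variables (f : Gr R -> R) (F : 'M[R]_4 -> R).
Hypothesis fF : C1_extension f F.

Lemma measurable_C1_extension :
  measurable_fun [set: GrBorel R] (fun T : GrBorel R => f T).
Proof.
have [FE [U [oU GU CF]]] := fF.
have -> : (fun T : GrBorel R => f T) = (fun T : GrBorel R => F (val (T : Gr R))).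
  by apply/funext => T; rewrite FE.
by apply: measurable_Gr => P /GU; exact: C1_on_continuous.
Qed.

Lemma measurable_grad i j :
  measurable_fun [set: GrBorel R] (fun T : GrBorel R => grad F (val (T : Gr R)) i j).
Proof.
have [FE [U [oU GU [_ CF]]]] := fF.
have -> : (fun T : GrBorel R => grad F (val (T : Gr R)) i j) =
  fun T : GrBorel R => 'd F (val (T : Gr R)) (delta_mx i j).
  by apply/funext => T; rewrite mxE.
by apply: (@measurable_Gr (fun P => 'd F P (delta_mx i j))) => P /GU; exact: CF.
Qed.

Lemma measurable_Bmx i j :
  measurable_fun [set: GrBorel R] (fun T : GrBorel R => Bmx f F T i j).
Proof.
pose P (T : GrBorel R) : 'M[R]_4 := val (T : Gr R).
have -> : (fun T : GrBorel R => Bmx f F T i j) = fun T : GrBorel R =>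
    f T * P T i j + \sum_k (\sum_l ((i == l)%:R - P T i l) *
      (grad F (P T) l k + grad F (P T) k l)) * P T k j.
  apply/funext => T; rewrite /Bmx -/(P T) mxE [X in X + _]mxE; congr (_ + _).
  rewrite mxE; apply: eq_bigr => k _; rewrite mxE; congr (_ * _).
  apply: eq_bigr => l _; rewrite mxE [1%:M i l]mxE [(- P T) i l]mxE; congr (_ * _).
  by rewrite mxE [(_^T) l k]mxE.
apply: measurable_funD.
  by apply: measurable_funM; [exact: measurable_C1_extension|exact: measurable_Gr_coord].
apply: measurable_sum => k; apply: measurable_funM; last exact: measurable_Gr_coord.
apply: measurable_sum => l; apply: measurable_funM.
  by apply: measurable_funB; [exact: measurable_cst|exact: measurable_Gr_coord].
by apply: measurable_funD; exact: measurable_grad.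
Qed.

End Measurability.

(** * Bounds for the entries of B and the kernel estimate *)

Section AC1.
Variables (R : realType) (p : R).
Hypothesis p_gt1 : 1 < p.
Let p_gt0 : 0 < p. Proof. by rewrite (lt_trans _ p_gt1). Qed.

(* The weight |X_ij|^p / |X|^(p-1) of the (i, j) coordinate, written as a
   function of the projection alone so that its measurability is visible. *)
Definition tweight (i j : 'I_4) (T : Gr R) : R :=
  Psi (lp_norm p) T `^ (1 - p) *
  (val T i i * val T j j - val T i j * val T j i) `^ (p / 2).

Section Frame.
Variables (T : Gr R) (V : 'M[R]_(2, 4)).
Hypothesis VV : V *m V^T = 1%:M.
Hypothesis VT : V^T *m V = val T.
Let X := plucker V.
Let N := psum p X.

Let N_gt0 : 0 < N. Proof. exact: psum_gt0. Qed.

(** By [gram_minor] the minor is X_ij^2, whose power p/2 is |X_ij|^p; and Psi^(1-p) =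
    N^((1-p)/p). *)
Lemma tweight_frame i j : tweight i j T = N `^ (p^-1 - 1) * `|X i j| `^ p.
Proof.
rewrite /tweight (Psi_frame p_gt1 VV VT) -VT gram_minor -/X -/N -powRrM.
have -> : p^-1 * (1 - p) = p^-1 - 1 by rewrite mulrBr mulr1 mulVf ?gt_eqF.
congr (_ * _); have -> : X i j * X i j = `|X i j| `^ 2%:R.
  by rewrite powR_mulrn // -normrX ger0_norm ?sqr_ge0 // expr2.
by rewrite -powRrM mulrCA mulfV ?mulr1 ?pnatr_eq0.
Qed.

Lemma sum_tweight_frame : \sum_i \sum_j tweight i j T = 2 * Psi (lp_norm p) T.
Proof.
have -> : \sum_i \sum_j tweight i j T = N `^ (p^-1 - 1) * \sum_i \sum_j `|X i j| `^ p.
  rewrite mulr_sumr; apply: eq_bigr => i _; rewrite mulr_sumr.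
  by apply: eq_bigr => j _; exact: tweight_frame.
have -> : \sum_i \sum_j `|X i j| `^ p = 2 * N by rewrite /N /psum mulrC divfK ?pnatr_eq0.
rewrite (Psi_frame p_gt1 VV VT) -/X -/N -(@mulr_powRB1 _ N p^-1) ?invr_gt0 ?(ltW N_gt0) //.
by rewrite mulrCA [N * _]mulrC.
Qed.

Lemma plucker_le2 i j : `|X i j| <= 2.
Proof.
rewrite -(@ler_pXn2r _ 2) ?nnegrE // -normrX ger0_norm ?sqr_ge0 //.
have := sum_sqr_plucker VV; rewrite (bigD1 i) //= (bigD1 j) //= -/X.
have : 0 <= \sum_(k < 4 | k != j) X i k ^+ 2 by rewrite sumr_ge0 // => k _; exact: sqr_ge0.
have : 0 <= \sum_(k < 4 | k != i) \sum_l X k l ^+ 2.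
  by rewrite sumr_ge0 // => k _; rewrite sumr_ge0 // => l _; exact: sqr_ge0.
set u := \sum_(k | _) _; set v := \sum_(k | _) _; move: (X i j ^+ 2) u v => x u v; lra.
Qed.

Lemma Psi_le_frame : Psi (lp_norm p) T <= (8 * 2 `^ p) `^ p^-1.
Proof.
rewrite (Psi_frame p_gt1 VV VT) -/X -/N; apply: ge0_ler_powR; rewrite ?invr_ge0 ?(ltW p_gt0) //.
- by rewrite nnegrE ltW.
- by rewrite nnegrE mulr_ge0 ?powR_ge0.
(* Sixteen terms of size at most 2^p, halved in [psum], give the constant 8. *)
have h : \sum_i \sum_j `|X i j| `^ p <= \sum_(i < 4) \sum_(j < 4) 2 `^ p.
  apply: ler_sum => i _; apply: ler_sum => j _; apply: ge0_ler_powR; rewrite ?nnegrE //.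
    exact: ltW.
  exact: plucker_le2.
rewrite !sumr_const !card_ord in h.
rewrite /N /psum ler_pdivrMr //; apply: le_trans h _.
by move: (2 `^ p) => x; lra.
Qed.

Lemma Psi_ge_frame : ((4^-1 `^ p) / 2) `^ p^-1 <= Psi (lp_norm p) T.
Proof.
rewrite (Psi_frame p_gt1 VV VT) -/X -/N; apply: ge0_ler_powR; rewrite ?invr_ge0 ?(ltW p_gt0) //.
- by rewrite nnegrE divr_ge0 ?powR_ge0.
- by rewrite nnegrE ltW.
(* If all sixteen entries were below 1/4, their squares would add up to at most 1, whereas the sum
   is 2. *)
have [[i j] /= ij] : exists ij : 'I_4 * 'I_4, 4^-1 <= `|X ij.1 ij.2|.
  apply/existsP; apply: contraT => /existsPn h; exfalso.
  have : \sum_i \sum_j X i j ^+ 2 <= \sum_(i < 4) \sum_(j < 4) (4^-1 ^+ 2 : R).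
    apply: ler_sum => i _; apply: ler_sum => j _.
    rewrite -[X in X <= _]ger0_norm ?sqr_ge0 // normrX lerXn2r ?nnegrE ?invr_ge0 //.
    by have := h (i, j); rewrite -ltNge => /ltW.
  by rewrite (sum_sqr_plucker VV) !sumr_const !card_ord; lra.
rewrite /N /psum ler_pM2r ?invr_gt0 //.
rewrite (bigD1 i) //= (bigD1 j) //= -addrA; apply: ler_wpDr.
  rewrite addr_ge0 // sumr_ge0 // => k _; rewrite ?powR_ge0 //.
  by rewrite sumr_ge0 // => l _; rewrite powR_ge0.
by apply: ge0_ler_powR; rewrite ?nnegrE ?invr_ge0 // ltW.
Qed.

Variable F : 'M[R]_4 -> R.
Hypothesis FE : C1_extension (Psi (lp_norm p)) F.

Lemma Bmx_entry_frame i j : Bmx (Psi (lp_norm p)) F T i j =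
  N `^ (p^-1 - 1) * \sum_k spow p (X i k) * X j k.
Proof.
rewrite (Bmx_frame p_gt1 FE VV VT) mxE; congr (_ * _).
by rewrite mxE; apply: eq_bigr => k _; rewrite mxE [(_^T) k j]mxE.
Qed.

Lemma Bmx_diag_frame i : Bmx (Psi (lp_norm p)) F T i i = \sum_k tweight i k T.
Proof.
rewrite Bmx_entry_frame mulr_sumr; apply: eq_bigr => k _.
by rewrite tweight_frame mulrC -(mul_spow p_gt1) [X i k * _]mulrC mulrC.
Qed.

Lemma Bmx_young_frame i j (a b : R) : i != j -> 0 < a -> 0 < b ->
  `|Bmx (Psi (lp_norm p)) F T i j| <= a `^ (p - 1) * b *
    ((1 - p^-1) * ((Bmx (Psi (lp_norm p)) F T i i - tweight i j T) / a `^ p) +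
     p^-1 * ((Bmx (Psi (lp_norm p)) F T j j - tweight i j T) / b `^ p)).
Proof.
move=> ij a0 b0; rewrite !Bmx_diag_frame Bmx_entry_frame.
have tji : tweight i j T = tweight j i T.
  by rewrite !tweight_frame /X pluckerC normrN.
(* Dropping k = j from row i gives, up to the factor N^(1/p-1), exactly B_ii - t_ij. *)
pose x (i j k : 'I_4) : R := if k == j then 0 else `|X i k| `^ p.
have xE i' j' : \sum_k tweight i' k T - tweight i' j' T =
    N `^ (p^-1 - 1) * \sum_k x i' j' k.
  rewrite (bigD1 j') //= addrAC subrr add0r [in RHS](bigD1 j') //=.
  rewrite [x i' j' j']/x eqxx add0r mulr_sumr.
  by apply: eq_bigr => k /negPf kj; rewrite tweight_frame /x kj.
have x_ge0 i' j' k : 0 <= x i' j' k by rewrite /x; case: ifP => // _; exact: powR_ge0.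
rewrite {2}tji !xE normrM ger0_norm ?powR_ge0 //.
set c := a `^ (p - 1) * b; set n := N `^ _.
have comb (u v s t w c' n' : R) :
    c' * ((1 - w) * (n' * u * s) + w * (n' * v * t)) =
    n' * (c' * ((1 - w) * (u * s) + w * (v * t))) by ring.
(* The indices k = i and k = j do not contribute, X being antisymmetric; this
   is what leaves [tweight i j T] out of both diagonal entries. *)
have term k : `|spow p (X i k) * X j k| <=
    c * ((1 - p^-1) * (x i j k / a `^ p) + p^-1 * (x j i k / b `^ p)).
  have pV : 0 <= 1 - p^-1 by rewrite subr_ge0 invf_le1 // ltW.
  have [ki|ki] := eqVneq k i; last have [kj|kj] := eqVneq k j.
  - rewrite ki {1}/X plucker_diag spow0 mul0r normr0 mulr_ge0 //.
      by rewrite mulr_ge0 ?powR_ge0 // ltW.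
    by rewrite addr_ge0 // mulr_ge0 ?divr_ge0 ?powR_ge0 // invr_ge0 ltW.
  - rewrite kj {2}/X plucker_diag mulr0 normr0 mulr_ge0 //.
      by rewrite mulr_ge0 ?powR_ge0 // ltW.
    by rewrite addr_ge0 // mulr_ge0 ?divr_ge0 ?powR_ge0 // invr_ge0 ltW.
  - by rewrite /x (negPf ki) (negPf kj); exact: young_spow.
have -> : c * ((1 - p^-1) * (n * (\sum_k x i j k) / a `^ p) +
               p^-1 * (n * (\sum_k x j i k) / b `^ p)) =
    n * \sum_k c * ((1 - p^-1) * (x i j k / a `^ p) + p^-1 * (x j i k / b `^ p)).
  rewrite -mulr_sumr big_split /= -!mulr_sumr -!mulr_suml.
  exact: comb.
rewrite ler_wpM2l ?powR_ge0 //.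
by apply: le_trans (ler_norm_sum _ _ _) _; apply: ler_sum => k _; exact: term.
Qed.

(** A crude bound for integrability: Young with a = b = 1, both weights at most 1, and each of the
    two row sums of |X|^p at most 2N. *)
Lemma norm_Bmx_le_frame i j :
  `|Bmx (Psi (lp_norm p)) F T i j| <= 4 * Psi (lp_norm p) T.
Proof.
rewrite Bmx_entry_frame normrM ger0_norm ?powR_ge0 //.
have sle i' : \sum_k `|X i' k| `^ p <= 2 * N.
  rewrite /N /psum [2 * _]mulrC divfK ?pnatr_eq0 // [leRHS](bigD1 i') //= lerDl.
  by rewrite sumr_ge0 // => k _; rewrite sumr_ge0 // => l _; rewrite powR_ge0.
have h : `|\sum_k spow p (X i k) * X j k| <= 4 * N.
  apply: le_trans (ler_norm_sum _ _ _) _.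
  have -> : 4 * N = 2 * N + 2 * N by ring.
  apply: le_trans (lerD (sle i) (sle j)); rewrite -big_split /=.
  apply: ler_sum => k _; have := young_spow p_gt1 (X i k) (X j k) ltr01 ltr01.
  rewrite !powR1 !mul1r !divr1 => /le_trans; apply.
  have pV : 0 < p^-1 by rewrite invr_gt0.
  have pV1 : p^-1 <= 1 by rewrite invf_le1 // ltW.
  by apply: lerD; rewrite ler_piMl ?powR_ge0 // lerBlDr lerDl ltW.
apply: le_trans (ler_wpM2l (powR_ge0 _ _) h) _.
rewrite (Psi_frame p_gt1 VV VT) -/X -/N -(@mulr_powRB1 _ N p^-1) ?invr_gt0 ?(ltW N_gt0) //.
by rewrite mulrCA [N * _]mulrC.
Qed.

End Frame.

Lemma tweight_ge0 i j T : 0 <= tweight i j T.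
Proof. by rewrite mulr_ge0 ?powR_ge0. Qed.

Lemma tweight_le i j T : tweight i j T <= 2 * Psi (lp_norm p) T.
Proof.
have [V VV VT] := orthonormal_frame T; rewrite -(sum_tweight_frame VV VT).
rewrite (bigD1 i) //= (bigD1 j) //= -addrA lerDl addr_ge0 // sumr_ge0 // => k _.
  exact: tweight_ge0.
by rewrite sumr_ge0 // => l _; exact: tweight_ge0.
Qed.

Lemma measurable_tweight i j (F : 'M[R]_4 -> R) : C1_extension (Psi (lp_norm p)) F ->
  measurable_fun [set: GrBorel R] (fun T : GrBorel R => tweight i j T).
Proof.
move=> FE; apply: measurable_funM.
  apply: (@measurableT_comp _ _ _ _ _ _ (@powR R ^~ (1 - p))) => //.
  exact: measurable_C1_extension FE.
apply: (@measurableT_comp _ _ _ _ _ _ (@powR R ^~ (p / 2))) => //.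
by apply: measurable_funB; apply: measurable_funM; exact: measurable_Gr_coord.
Qed.

(** Psi is bounded uniformly by [Psi_le_frame], and a bounded measurable function is integrable for
    a probability. *)
Lemma integrable_le_Psi (mu : probability (GrBorel R) R) (f : GrBorel R -> R) (c : R) :
  0 <= c -> measurable_fun setT f -> (forall T, `|f T| <= c * Psi (lp_norm p) T) ->
  mu.-integrable setT (EFin \o f).
Proof.
move=> c0 mf fb; apply: measurable_bounded_integrable => //.
  exact: (eq_ind_r (fun x => (x < +oo)%E) (ltry 1) (probability_setT mu)).
exists (c * (8 * 2 `^ p) `^ p^-1); split; rewrite ?num_real // => x Mx T _ /=.
apply: le_trans (ltW Mx); apply: le_trans (fb T) _; rewrite ler_wpM2l //.
by have [V VV VT] := orthonormal_frame T; exact: Psi_le_frame VV VT.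
Qed.

Lemma AC1_Psi : AC1 (Psi (lp_norm p)).
Proof.
move=> F FE mu.
pose B i j (T : GrBorel R) := Bmx (Psi (lp_norm p)) F T i j.
pose t i j (T : GrBorel R) := tweight i j T.
have [i [j ij]] : exists i j : 'I_4, \int[mu]_T B i i T * \int[mu]_T B j j T !=
    \int[mu]_T B i j T * \int[mu]_T B j i T.
  apply: (@exists_minor_neq0 _ _ _ mu p 4 B t) => //.
  - move=> i j; apply: (@integrable_le_Psi _ _ 4) => //.
      exact: measurable_Bmx.
    by move=> T; have [V VV VT] := orthonormal_frame T; exact: norm_Bmx_le_frame VV VT _ FE _ _.
  - move=> i j; apply: (@integrable_le_Psi _ _ 2) => //.
      exact: measurable_tweight FE.
    by move=> T; rewrite ger0_norm ?tweight_ge0 //; exact: tweight_le.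
  - by move=> i j T; exact: tweight_ge0.
  - move=> i j T; have [V VV VT] := orthonormal_frame T.
    by rewrite /t !(tweight_frame VV VT) pluckerC normrN.
  - move=> i T; have [V VV VT] := orthonormal_frame T.
    by rewrite /t (tweight_frame VV VT) plucker_diag normr0 powR0 ?gt_eqF ?mulr0.
  - by move=> i T; have [V VV VT] := orthonormal_frame T; exact: Bmx_diag_frame VV VT _ FE _.
  - by move=> i j T a b; have [V VV VT] := orthonormal_frame T;
      exact: Bmx_young_frame VV VT _ FE _ _ _ _.
  (* The weights add up to 2 Psi, and [Psi_ge_frame] bounds Psi from below uniformly. *)
  - exists (2 * ((4^-1 `^ p) / 2) `^ p^-1).
      by rewrite mulr_gt0 // powR_gt0 // divr_gt0 // powR_gt0 // invr_gt0.
    move=> T; have [V VV VT] := orthonormal_frame T.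
    by rewrite (sum_tweight_frame VV VT) ler_wpM2l // (Psi_ge_frame VV VT).
by apply: (@dim_ker_le2 _ _ i j); rewrite !mxE.
Qed.

End AC1.

Theorem theorem6p1 (R : realType) (p : R) (hp : 1 < p) :
  [/\ C1_Gr (Psi (lp_norm p)),
      (forall T : Gr R, 0 < Psi (lp_norm p) T) &
      AC1 (Psi (lp_norm p))].
Proof. by split; [exact: C1_Psi|exact: Psi_gt0|exact: AC1_Psi]. Qed.
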